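(* Let $\mu\in(k-1,k]$ with $k\in\mathbb N$, $k\ge1$, and let $\theta\in(-1,1)$. If $u,u',\dots,u^{(k-1)}\in\mathrm{AC}([-1,1])$, ${}^{C}\!D_{\theta+}^{\mu}u\in\mathrm{BV}([\theta,1])$ and ${}^{C}\!D_{\theta-}^{\mu}u\in\mathrm{BV}([-1,\theta])$, then for each integer $n\ge\mu+1$ the Legendre expansion coefficient $\hat u_n^L=\frac{2n+1}{2}\int_{-1}^1u(x)P_n(x)\,\mathrm dx$ satisfies $$\hat u_n^L=\frac{2n+1}{2}\Big\{(I_{1-}^{\mu+1}P_n)(\theta)\,({}^{C}\!D_{\theta+}^{\mu}u)(\theta+)+\int_\theta^1(I_{1-}^{\mu+1}P_n)(x)\,\mathrm d\{{}^{C}\!D_{\theta+}^{\mu}u(x)\}$$ $$\qquad\qquad+(I_{-1+}^{\mu+1}P_n)(\theta)\,({}^{C}\!D_{\theta-}^{\mu}u)(\theta-)-\int_{-1}^\theta(I_{-1+}^{\mu+1}P_n)(x)\,\mathrm d\{{}^{C}\!D_{\theta-}^{\mu}u(x)\}\Big\},$$ where $$(I_{1-}^{\mu+1}P_n)(x)=\frac{(1-x)^{\mu+1}}{\Gamma(\mu+2)}\frac{P_n^{(\mu+1,-\mu-1)}(x)}{P_n^{(\mu+1,-\mu-1)}(1)},\qquad (I_{-1+}^{\mu+1}P_n)(x)=\frac{(1+x)^{\mu+1}}{\Gamma(\mu+2)}\frac{P_n^{(-\mu-1,\mu+1)}(x)}{P_n^{(\mu+1,-\mu-1)}(1)}.$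$
   Context: $P_n$ is the Legendre polynomial of degree $n$ (with $P_n(1)=1$). For arbitrary real $\alpha,\beta$, the generalised Jacobi polynomial is $P_n^{(\alpha,\beta)}(x)=\frac{(\alpha+1)_n}{n!}\,{}_2F_1\big(-n,n+\alpha+\beta+1;\alpha+1;\frac{1-x}2\big)$, extended by continuity in $\alpha$ when $\alpha$ is a negative integer, i.e. $P_n^{(\alpha,\beta)}(x)=\sum_{j=0}^n\frac{(n+\alpha+\beta+1)_j(\alpha+j+1)_{n-j}}{j!\,(n-j)!}\big(\frac{x-1}{2}\big)^j$, where $(c)_j=c(c+1)\cdots(c+j-1)$, $(c)_0=1$. $\mathrm{AC}$ and $\mathrm{BV}$ denote absolutely continuous functions and functions of bounded variation on the indicated closed interval. Fractional integrals: for $\rho>0$ and $f\in L^1(a,b)$, $(I_{a+}^\rho f)(x)=\frac1{\Gamma(\rho)}\int_a^x\frac{f(y)}{(x-y)^{1-\rho}}\,\mathrm dy$ and $(I_{b-}^\rho f)(x)=\frac1{\Gamma(\rho)}\int_x^b\frac{f(y)}{(y-x)^{1-\rho}}\,\mathrm dy$; $I^0_{a+}$ and $I^0_{b-}$ are the identity. Caputo derivatives: for $\mu\in(k-1,k]$, $({}^{C}\!D_{a+}^{\mu}f)(x)=(I_{a+}^{k-\mu}f^{(k)})(x)$ and $({}^{C}\!D_{b-}^{\mu}f)(x)=(-1)^k(I_{b-}^{k-\mu}f^{(k)})(x)$. These are defined almost everywhere; saying that such a function is in BV means it agrees a.e. with a BV function, with which it is then identified. $h(c\pm)$ denote one-sided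 limits. For $h\in\mathrm{BV}([c,d])$ and $\varphi$ continuous, $\int_c^d\varphi\,\mathrm dh$ is the Riemann–Stieltjes integral taken without jump contributions at the endpoints, i.e. with $h(c),h(d)$ understood as $h(c+),h(d-)$ (integral over the open interval $(c,d)$). *)

(* Defs.v *)
From HB Require Import structures.
From mathcomp Require Import all_boot all_order all_algebra.
From mathcomp Require Import all_classical all_reals all_analysis.

Set Implicit Arguments.
Unset Strict Implicit.
Unset Printing Implicit Defensive.
Import Order.TTheory GRing.Theory Num.Theory.
Import numFieldNormedType.Exports.

Local Open Scope classical_set_scope.
Local Open Scope ring_scope.

(* Rodrigues' formula. *)
Definition legendre {R : realType} (n : nat) : {poly R} :=
  ((2 ^+ n * n`!%:R)^-1) *: (('X ^+ 2 - 1) ^+ n)^`(n).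

Lemma legendre1 {R : realType} (n : nat) : (legendre n).[1] = 1 :> R.
Proof.
have step m (q : {poly R}) :
    ((('X - 1) ^+ m * q)^`(m)).[1] = m`!%:R * q.[1].
  elim: m q => [|m IHm] q; first by rewrite expr0 !mul1r.
  have -> : (('X - 1) ^+ m.+1 * q)^`(m.+1) =
      (('X - 1) ^+ m * (q *+ m.+1 + ('X - 1) * q^`()))^`(m).
    rewrite derivSn derivM deriv_exp derivB derivX derivC subr0 mul1r /=.
    by congr (_^`(m)); rewrite mulrDr mulrA -exprSr mulrnAl mulrnAr.
  rewrite IHm hornerD hornerM hornerMn hornerD hornerN hornerX hornerC subrr.
  by rewrite mul0r addr0 factS -[q.[1] *+ _]mulr_natl mulrA -natrM mulnC.
rewrite /legendre -[in X in 'X ^+ 2 - X](expr1n _ 2) subr_sqr.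
rewrite hornerZ exprMn step horner_exp hornerD hornerX hornerC.
by rewrite [_ * (1 + 1) ^+ n]mulrC mulVf // mulf_neq0 //.
Qed.

(* The rising factorial (c)_j. *)
Definition pochhammer {R : realType} (c : R) (j : nat) : R :=
  \prod_(i < j) (c + i%:R).

(* Generalised Jacobi polynomial for arbitrary real parameters.  This is the
   expansion of the hypergeometric formula in powers of (x - 1) / 2, which makes
   sense also when al is a negative integer. *)
Definition jacobi {R : realType} (al be : R) (n : nat) (x : R) : R :=
  \sum_(j < n.+1)
    pochhammer (n%:R + al + be + 1) j * pochhammer (al + j%:R + 1) (n - j)
    / (j`! * (n - j)`!)%:R * ((x - 1) / 2) ^+ j.

(* Euler's integral; meaningful for 0 < x. *)
Definition Gamma {R : realType} (x : R) : R :=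
  \int[lebesgue_measure]_(t in `]0, +oo[) (t `^ (x - 1) * expR (- t)).

(* I_{a+}^rho and I_{b-}^rho for 0 <= rho. *)
Definition frac_int_left {R : realType} (a rho : R) (f : R -> R) (x : R) : R :=
  if rho == 0 then f x else
  (Gamma rho)^-1 *
    \int[lebesgue_measure]_(y in `]a, x[) (f y / (x - y) `^ (1 - rho)).

Definition frac_int_right {R : realType} (b rho : R) (f : R -> R) (x : R) : R :=
  if rho == 0 then f x else
  (Gamma rho)^-1 *
    \int[lebesgue_measure]_(y in `]x, b[) (f y / (y - x) `^ (1 - rho)).

(* Derivatives relative to a set A: for A a closed interval this is the usual
   derivative at interior points and the one-sided derivative at endpoints, so
   that only the values of f on A matter.  The derivative is 0 by convention at
   the points where it does not exist. *)
Definition derivable_on {R : realType} (A : set R) (f : R -> R) (x : R) : Prop :=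
  cvg ((f y - f x) / (y - x) @[y --> within A x^']).

Definition derive_on {R : realType} (A : set R) (f : R -> R) (x : R) : R :=
  lim ((f y - f x) / (y - x) @[y --> within A x^']).

Definition derive_on_n {R : realType} (A : set R) (j : nat) (f : R -> R) :
    R -> R :=
  iter j (derive_on A) f.

Definition abs_cont {R : realType} (a b : R) (f : R -> R) : Prop :=
  forall e : R, 0 < e -> exists2 d : R, 0 < d &
    forall (m : nat) (p q : 'I_m -> R),
      (forall i, a <= p i /\ p i <= q i /\ q i <= b) ->
      trivIset setT (fun i => `]p i, q i[%classic) ->
      \sum_i (q i - p i) < d ->
      \sum_i `|f (q i) - f (p i)| < e.

(* f, f', ..., f^(k-1) exist everywhere on [a, b] and belong to AC([a, b]). *)
Definition abs_cont_derivs {R : realType} (a b : R) (k : nat) (f : R -> R) :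
    Prop :=
  forall j, (j < k)%N ->
    (forall i x, (i < j)%N -> x \in `[a, b] ->
       derivable_on `[a, b] (derive_on_n `[a, b] i f) x) /\
    abs_cont a b (derive_on_n `[a, b] j f).

(* Caputo derivatives of order mu in ]k - 1, k] based at c, for a function f
   given on the interval A.  The value is meaningful for almost every x. *)
Definition caputo_left {R : realType} (A : set R) (c : R) (k : nat) (mu : R)
    (f : R -> R) : R -> R :=
  frac_int_left c (k%:R - mu) (derive_on_n A k f).

Definition caputo_right {R : realType} (A : set R) (c : R) (k : nat) (mu : R)
    (f : R -> R) (x : R) : R :=
  (-1) ^+ k * frac_int_right c (k%:R - mu) (derive_on_n A k f) x.

(* Riemann-Stieltjes sum for the subdivision a :: s of [a, b] and the tags t. *)
Definition RS_sum {R : realType} (a b : R) (phi h : R -> R) (s : seq R)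
    (t : nat -> R) : R :=
  \sum_(i < size s)
    phi (t i) * (h (nth b (a :: s) i.+1) - h (nth b (a :: s) i)).

Definition is_RS_integral {R : realType} (a b : R) (phi h : R -> R) (I : R) :
    Prop :=
  forall e : R, 0 < e -> exists2 d : R, 0 < d &
    forall (s : seq R) (t : nat -> R),
      itv_partition a b s ->
      (forall i, (i < size s)%N ->
         nth b (a :: s) i <= t i /\ t i <= nth b (a :: s) i.+1 /\
         nth b (a :: s) i.+1 - nth b (a :: s) i < d) ->
      `|RS_sum a b phi h s t - I| < e.

Definition RS_integral {R : realType} (a b : R) (phi h : R -> R) : R :=
  get [set I | is_RS_integral a b phi h I].

(* h with h(a), h(b) replaced by h(a+), h(b-). *)
Definition inner_ends {R : realType} (a b : R) (h : R -> R) (x : R) : R :=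
  if x == a then lim (h y @[y --> a^'+])
  else if x == b then lim (h y @[y --> b^'-])
  else h x.

(* Riemann-Stieltjes integral without jump contributions at the endpoints. *)
Definition RS_integral_oo {R : realType} (a b : R) (phi h : R -> R) : R :=
  RS_integral a b phi (inner_ends a b h).

Definition legendre_coef {R : realType} (u : R -> R) (n : nat) : R :=
  (2 * n%:R + 1) / 2 *
    \int[lebesgue_measure]_(x in `[-1, 1]) (u x * (legendre n).[x]).

(* Main.v *)
(* Integrate by parts k times over the whole of [-1, 1], against the iterated
   primitives of P_n: by Rodrigues' formula these vanish at both endpoints, so
   there are no boundary terms, and since u, ..., u^(k-1) are absolutely
   continuous on [-1, 1] none arise at theta either. The k-th primitive is
   I_{1-}^k P_n = I_{1-}^{k-mu} (I_{1-}^mu P_n), up to sign also the left-sided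
   integral. On each side of theta, Fubini moves I^{k-mu} onto u^(k), which
   produces the Caputo derivative; it may be replaced by its BV representative,
   and as I^{mu+1} P_n is a primitive of I^mu P_n up to sign, a Riemann-Stieltjes
   integration by parts gives the two terms of that side.

   P_n is a finite sum of powers of 1 - x, so all the fractional integrals of
   P_n are explicit by the Gamma-Beta relation, and the Jacobi form follows from
   the Chu-Vandermonde identity. Integration by parts for absolutely continuous
   functions comes from the total variation: it is absolutely continuous, so the
   associated Stieltjes measures are dominated by Lebesgue measure and
   Radon-Nikodym supplies the derivative. *)
From HB Require Import structures.
Require Import Defs.
From mathcomp Require Import all_boot all_order all_algebra.
From mathcomp Require Import all_classical all_reals all_analysis.
From mathcomp Require Import measurable_realfun ring lra zify.
Import Order.TTheory GRing.Theory Num.Theory.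
Import numFieldNormedType.Exports.
Set Implicit Arguments.
Unset Strict Implicit.
Unset Printing Implicit Defensive.
Local Open Scope classical_set_scope.
Local Open Scope ring_scope.

(** Everything rests on one family of functions, [powsum c N r], whose terms are normalised by Gamma
    factors so that a right-sided fractional integration from 1 only adds its order to the parameter
    [r]. The law that splits the order [k] into [mu] and [k - mu] becomes addition of parameters,
    and [P_n], its primitives and its right-sided fractional integrals share the same coefficients.
    The left-sided integrals are the same family at [- x], with coefficients multiplied by
    [(-1) ^+ n]; parity of [P_n] connects the two sides.

    The classical integration by parts is the Fubini exchange at order 1: [f - f (-1)] is the
    first-order integral of the derivative, so the same exchange serves for the [k] integer steps
    and for the fractional one.

    In the Stieltjes step the integrator has only bounded variation and may jump, so all regularity
    lies on the integrand: it is a primitive of a bounded function, which controls the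
    Riemann-Stieltjes sums of a monotone integrator directly. *)

(** * Invariance of the integral under changes on null sets *)

Section ae_integral.
Import HBNNSimple.
Context d (T : measurableType d) (R : realType) (mu : {measure set T -> \bar R}).
Local Open Scope ereal_scope.

(* Measurability is not assumed because derivatives relative to a set are only
   known to agree almost everywhere with measurable functions. *)
Lemma le_integral_nonmeasurable (f g : T -> \bar R) :
  (forall x, 0 <= f x) -> (forall x, 0 <= g x) ->
  {ae mu, forall x, f x <= g x} -> \int[mu]_x f x <= \int[mu]_x g x.
Proof.
move=> f0 g0 [N [mN N0 fgN]].
rewrite !ge0_integralTE//; apply: ge_ereal_sup => _ [h /= hf <-].
have mN' : measurable (~` N) by exact: measurableC.
(* The integral of a nonnegative function is a supremum over simple functions below it. Cutting such
   a function to zero on the exceptional null set puts it below [g] everywhere and leaves its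
   integral unchanged. *)
pose h' : {nnsfun T >-> R} := mul_nnsfun h (indic_nnsfun R mN').
have h'E x : h' x = (h x * \1_(~` N) x)%R by [].
apply: ereal_sup_ubound; exists h' => //=.
  move=> x; rewrite -[X in (X%:E <= _)%E]/(h' x) h'E indicE; case: (boolP (x \in ~` N)) => xN /=.
    rewrite mulr1; apply: (le_trans (hf x)).
    by apply: contrapT => fgx; move: xN; rewrite inE; apply; exact: fgN.
  by rewrite mulr0.
rewrite -!integralT_nnsfun; apply: ae_eq_integral => //.
- exact/measurable_EFinP.
- exact/measurable_EFinP.
exists N; split => //; apply: subsetCl => x /= Nx _.
suff E : h' x = h x by exact: (congr1 EFin E).
by rewrite h'E indicE mem_set ?mulr1//.
Qed.

Lemma integral_ae_nonmeasurable (D : set T) (f g : T -> \bar R) :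
  f = g %[ae mu in D] -> \int[mu]_(x in D) f x = \int[mu]_(x in D) g x.
Proof.
move=> fg.
have FG : {ae mu, forall x, (f \_ D) x = (g \_ D) x}.
  move: fg; apply: filterS => x fgx; rewrite !patchE.
  by case: ifPn => // /[!inE]; exact: fgx.
have key (u v : T -> \bar R) : (forall x, 0 <= u x) -> (forall x, 0 <= v x) ->
    {ae mu, forall x, u x = v x} -> \int[mu]_x u x = \int[mu]_x v x.
  move=> u0 v0 uv; apply/eqP; rewrite eq_le.
  by apply/andP; split; apply: le_integral_nonmeasurable => //;
    move: uv; apply: filterS => x ->.
rewrite integral_mkcond [RHS]integral_mkcond integralE [RHS]integralE.
congr (_ - _); apply: key => //; apply: filterS FG => x fgx.
- by rewrite !funeposE fgx.
- by rewrite !funenegE fgx.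
Qed.

End ae_integral.

(** * Absolutely continuous functions and their total variation *)

Section absolute_continuity.
Context {R : realType}.
Implicit Types (a b e : R) (f g : R -> R).

(** The cells of several partitions are naturally indexed by dependent pairs, hence the passage from
    ordinals to arbitrary finite index types. *)
Lemma abs_cont_finType a b f e : abs_cont a b f -> 0 < e ->
  exists2 d : R, 0 < d & forall (I : finType) (p q : I -> R),
    (forall i, a <= p i /\ p i <= q i /\ q i <= b) ->
    trivIset setT (fun i => `]p i, q i[%classic) ->
    \sum_i (q i - p i) < d -> \sum_i `|f (q i) - f (p i)| < e.
Proof.
move=> acf /acf[d d0 dP]; exists d => // I p q pq tpq sd.
have bij := onW_bij predT (@enum_val_bij I).
rewrite (reindex _ bij)/=.
apply: (dP _ (p \o enum_val) (q \o enum_val)) => /=.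
- by move=> i; exact: pq.
- by move=> i j _ _ /(tpq _ _ Logic.I Logic.I)/enum_val_inj.
- by rewrite (reindex _ bij) in sd.
Qed.

Lemma abs_contB a b f g :
  abs_cont a b f -> abs_cont a b g -> abs_cont a b (f \- g).
Proof.
move=> acf acg e e0.
have [d d0 dP] := acf _ (divr_gt0 e0 (ltr0n _ 2)).
have [d' d'0 dP'] := acg _ (divr_gt0 e0 (ltr0n _ 2)).
exists (Num.min d d'); first by rewrite lt_min d0.
move=> m p q pq tpq; rewrite lt_min => /andP[sd sd'].
rewrite [e]splitr; apply: le_lt_trans (ltrD (dP _ _ _ pq tpq sd) (dP' _ _ _ pq tpq sd')).
rewrite -big_split/=; apply: ler_sum => i _.
apply: le_trans (ler_normB _ _); rewrite le_eqVlt; apply/orP; left.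
by apply/eqP; congr Num.norm => /=; ring.
Qed.

Lemma abs_cont_small a b f e : abs_cont a b f -> 0 < e ->
  exists2 d : R, 0 < d & forall x y, a <= x -> x <= y -> y <= b -> y - x < d ->
    `|f y - f x| < e.
Proof.
move=> acf /(abs_cont_finType acf)[d d0 dP]; exists d => // x y ax xy yb xyd.
have := dP unit (fun=> x) (fun=> y); rewrite !big_const !card_unit /= !addr0.
by apply => //; move=> [] [].
Qed.

Lemma itv_partition_nth_homo a b (s : seq R) i j : itv_partition a b s ->
  (i <= j)%N -> (j <= size s)%N -> nth b (a :: s) i <= nth b (a :: s) j.
Proof.
move=> [pas _] ij js.
have les : sorted <=%R (a :: s) by exact: (sub_path (@ltW _ _)) pas.
by apply: (sorted_leq_nth le_trans lexx b les); rewrite ?inE ?ltnS//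
  (leq_trans ij).
Qed.

Lemma trivIset_itv_ord m (p q : 'I_m -> R) :
  (forall i j : 'I_m, (i < j)%N -> q i <= p j) ->
  trivIset setT (fun i => `]p i, q i[%classic).
Proof.
move=> qp i j _ _ [x []] /=; rewrite !in_itv/= => /andP[pix xqi] /andP[pjx xqj].
apply/val_inj; case: (ltngtP (val i) (val j)) => // /qp.
- by move/(lt_le_trans xqi)/lt_trans => /(_ _ pjx); rewrite ltxx.
- by move/(lt_le_trans xqj)/lt_trans => /(_ _ pix); rewrite ltxx.
Qed.

(** Cutting each interval by a partition preserves disjointness and total length, so the family of
    all the pieces is again admissible for the same [d]. *)
Lemma abs_cont_variation a b f e : abs_cont a b f -> 0 < e ->
  exists2 d : R, 0 < d &
    forall (m : nat) (p q : 'I_m -> R) (s : 'I_m -> seq R),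
    (forall i, a <= p i /\ p i <= q i /\ q i <= b) ->
    trivIset setT (fun i => `]p i, q i[%classic) ->
    (forall i, itv_partition (p i) (q i) (s i)) ->
    \sum_i (q i - p i) < d ->
    \sum_i variation (p i) (q i) f (s i) < e.
Proof.
move=> acf /(abs_cont_finType acf)[d d0 dP]; exists d => // m p q s pq tpq sP sd.
have sumsig (F : R -> R -> R) :
    \sum_i \sum_(0 <= j < size (s i))
      F (nth (q i) (p i :: s i) j) (nth (q i) (p i :: s i) j.+1) =
    \sum_(k : {i : 'I_m & 'I_(size (s i))})
      F (nth (q (tag k)) (p (tag k) :: s (tag k)) (tagged k))
        (nth (q (tag k)) (p (tag k) :: s (tag k)) (tagged k).+1).
  under eq_bigr do rewrite big_mkord.
  by rewrite (sig_big_dep xpredT (fun=> xpredT) (fun i (j : 'I_(size (s i))) =>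
    F (nth (q i) (p i :: s i) j) (nth (q i) (p i :: s i) j.+1))).
rewrite (sumsig (fun x y => `|f y - f x|)); apply: dP => /=.
- move=> [i j] /=; have [ap [_ qb]] := pq i.
  have := sP i => siP; split; [|split].
  + apply: (le_trans ap); apply: (itv_partition_nth_homo (i := 0%N) siP) => //.
    exact/ltnW.
  + exact: (itv_partition_nth_homo siP (leqnSn j) (ltn_ord j)).
  + apply: le_trans qb.
    have := itv_partition_nth_homo siP (ltn_ord j) (leqnn _).
    by rewrite (itv_partition_nth_size (q i) siP).
- move=> [i j] [i' j'] _ _ /= [x [/= xi xi']].
  have sub k (l : 'I_(size (s k))) :
      `]nth (q k) (p k :: s k) l, nth (q k) (s k) l[%classic
        `<=` `]p k, q k[%classic.
    move=> y /=; rewrite !in_itv/= => /andP[h1 h2]; apply/andP; split.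
      by apply: le_lt_trans h1; apply: (itv_partition_nth_homo (i := 0%N) (sP k)) => //; exact/ltnW.
    apply: (lt_le_trans h2).
    have := itv_partition_nth_homo (sP k) (ltn_ord l) (leqnn _).
    by rewrite (itv_partition_nth_size (q k) (sP k)).
  have ii' : i = i' by apply: tpq => //; exists x; split; [exact: sub xi|exact: sub xi'].
  subst i'; congr existT.
  have := @trivIset_itv_ord _ (fun l : 'I_(size (s i)) => nth (q i) (p i :: s i) l)
    (fun l => nth (q i) (p i :: s i) l.+1).
  apply => //; last by exists x.
  by move=> k l kl; exact: itv_partition_nth_homo (sP i) kl (ltnW (ltn_ord l)).
- rewrite -(sumsig (fun x y => y - x)).
  rewrite (eq_bigr (fun i => q i - p i))// => i _.
  by rewrite (telescope_sumr _ (leq0n _))// (itv_partition_nth_size (q i) (sP i)).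
Qed.

End absolute_continuity.

Section abs_cont_tv.
Context {R : realType}.
Implicit Types (a b e : R) (f g : R -> R).

(** The previous estimate on a single interval shorter than [d] bounds its variation by 1. Steps of
    length [d / 2], strictly below [d], reach every point of [[a, b]] in finite number, and total
    variation is additive. *)
Lemma abs_cont_bounded_variation a b f : abs_cont a b f ->
  bounded_variation a b f.
Proof.
move=> acf; have [ab|ba] := leP a b; last first.
  by exists 0 => r [s /itv_partition_le]; rewrite leNgt ba.
have [d d0 dP] := abs_cont_variation acf ltr01.
have small x y : a <= x -> x <= y -> y <= b -> y - x < d ->
    total_variation x y f \is a fin_num.
  move=> ax xy yb yxd; apply/bounded_variationP => //; exists 1 => _ [s xys <-].
  have := @dP 1%N (fun=> x) (fun=> y) (fun=> s); rewrite !big_ord1 => H.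
  have t1 : trivIset setT (fun i : 'I_1 => `]x, y[%classic).
    by move=> i j _ _ _; rewrite (ord1 i) (ord1 j).
  by apply: ltW; apply: H.
have step n y : a <= y -> y <= b -> y - a <= n%:R * (d / 2) ->
    total_variation a y f \is a fin_num.
  elim: n y => [|n ih] y ay yb.
    rewrite mul0r subr_le0 => ya; have -> : y = a by apply/le_anti; rewrite ya.
    by rewrite total_variationxx.
  move=> yan; set x := Num.max a (y - d / 2).
  have ax : a <= x by rewrite le_max lexx.
  have xy : x <= y by rewrite ge_max ay lerBlDr lerDl divr_ge0 // ltW.
  have xyd : y - x < d by rewrite /x; case: (leP a (y - d / 2)) => h; lra.
  have xan : x - a <= n%:R * (d / 2).
    rewrite /x; case: (leP a (y - d / 2)) => h; first by rewrite -natr1 mulrDl mul1r in yan; lra.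
    by rewrite subrr mulr_ge0// divr_ge0// ltW.
  by rewrite (total_variationD f ax xy) fin_numD ih ?small// (le_trans xy).
apply/bounded_variationP => //.
apply: (step (Num.truncn ((b - a) / (d / 2))).+1) => //.
rewrite -ler_pdivrMr ?divr_gt0//; apply/ltW.
exact: truncnS_gt.
Qed.

Lemma total_variationB a x y f : a <= x -> x <= y -> bounded_variation a y f ->
  fine (total_variation a y f) - fine (total_variation a x f) =
  fine (total_variation x y f).
Proof.
move=> ax xy bv; rewrite (total_variationD f ax xy) fineD.
- by rewrite addrAC subrr add0r.
- by apply/bounded_variationP => //; exact: bounded_variationl bv.
- by apply/bounded_variationP => //; exact: bounded_variationr bv.
Qed.

(** On each interval of the family some partition comes within [h] of the total variation, and the
    variations along these partitions are small together. *)
Lemma abs_cont_total_variation a b f : abs_cont a b f ->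
  abs_cont a b (fun x => fine (total_variation a x f)).
Proof.
move=> acf e e0; have bv := abs_cont_bounded_variation acf.
have [d d0 dP] := abs_cont_variation acf (divr_gt0 e0 (ltr0n _ 2)).
exists d => // m p q pq tpq sd.
(* The [m] errors [h] add up to at most [e / 2]; dividing by [m.+1] covers the empty family. *)
set h := e / 2 / m.+1%:R.
have h0 : 0 < h by rewrite !divr_gt0.
have bvi i : bounded_variation (p i) (q i) f.
  have [ap [piq qb]] := pq i.
  exact: bounded_variationr ap piq (bounded_variationl (le_trans ap piq) qb bv).
have /choice[s sP] : forall i, exists s, itv_partition (p i) (q i) s /\
    fine (total_variation (p i) (q i) f) - h < variation (p i) (q i) f s.
  move=> i; have [ap [piq qb]] := pq i.
  have fin : total_variation (p i) (q i) f \is a fin_num by apply/bounded_variationP.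
  have : ((fine (total_variation (p i) (q i) f) - h)%:E <
      total_variation (p i) (q i) f)%E.
    by rewrite -[ltRHS]fineK// lte_fin ltrBlDr ltrDl.
  move/ereal_sup_gt => [_ [_ [s ps <-] <-]]; rewrite lte_fin => sh.
  by exists s.
have := dP _ _ _ s pq tpq (fun i => (sP i).1) sd => ve.
rewrite [e]splitr; apply: (@le_lt_trans _ _
  (\sum_i (variation (p i) (q i) f (s i) + h))).
  apply: ler_sum => i _; have [ap [piq qb]] := pq i.
  rewrite total_variationB//; last first.
    exact: bounded_variationl (le_trans ap piq) qb bv.
  rewrite ger0_norm; last by rewrite fine_ge0// total_variation_ge0.
  by rewrite -lerBlDr; apply/ltW; case: (sP i).
rewrite big_split/=; apply: ltr_leD => //.
rewrite sumr_const card_ord -[leLHS]mulr_natr /h mulrAC ler_pdivrMr//.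
by rewrite ler_wpM2l ?divr_ge0 ?ltW// ltr_nat.
Qed.

End abs_cont_tv.

(** * Monotone absolutely continuous functions as integrals *)

Section monotone_abs_cont.
Context {R : realType}.
Implicit Types (a b e : R) (F G : R -> R).
Local Notation mu := (@lebesgue_measure R).

(** A Stieltjes measure requires a nondecreasing right-continuous function on the whole line.
    Composition with the clamp [cl] onto [[a, b]] extends [F] by constants, and since [cl] does not
    increase distances, continuity follows from absolute continuity. *)
Lemma cumulative_extension a b F : a <= b ->
  {in `[a, b] &, {homo F : x y / x <= y}} -> abs_cont a b F ->
  exists G : cumulative R R, {in `[a, b], G =1 F}.
Proof.
move=> ab ndF acF.
pose cl x := Num.max a (Num.min x b).
have clab x : cl x \in `[a, b].
  by rewrite in_itv/= /cl le_max lexx ge_max ab ge_min lexx orbT.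
have clE x : [\/ cl x = a /\ x <= a, cl x = x /\ a <= x <= b | cl x = b /\ b <= x].
  rewrite /cl; case: (leP x b) => xb; last first.
    by rewrite (max_idPr ab); apply: Or33; split; rewrite ?ltW.
  by case: (leP a x) => ax; [apply: Or32; rewrite ?xb | apply: Or31; rewrite ltW].
have ndcl x y : x <= y -> cl x <= cl y.
  by move=> xy; case: (clE x) => -[->] hx; case: (clE y) => -[->] hy; lra.
have clB x y : x <= y -> cl y - cl x <= y - x.
  by move=> xy; case: (clE x) => -[->] hx; case: (clE y) => -[->] hy; lra.
pose G := F \o cl.
have ndG : {homo G : x y / x <= y}.
  by move=> x y xy; apply: ndF => //; exact: ndcl.
have rcG : right_continuous G.
  move=> x; apply/cvgrPdist_lt => e e0.
  have [d d0 dP] := abs_cont_small acF e0.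
  near=> y; have xy : x <= y by near: y; exact: nbhs_right_ge.
  have yxd : y - x < d.
    by rewrite ltrBlDl; near: y; apply: nbhs_right_lt; rewrite ltrDl.
  rewrite distrC; apply: dP.
  - by have := clab x; rewrite in_itv => /andP[].
  - exact: ndcl.
  - by have := clab y; rewrite in_itv => /andP[].
  - exact: le_lt_trans (clB _ _ xy) yxd.
pose GC : cumulative R R := HB.pack G (isCumulative.Build R _ R G ndG rcG).
exists GC => x /=; rewrite in_itv/= => /andP[ax xb].
by rewrite /G /= /cl (min_idPl xb) (max_idPr ax).
Unshelve. all: by end_near. Qed.

Lemma stieltjes_itv_oc (G : cumulative R R) a b : a <= b ->
  lebesgue_stieltjes_measure G `]a, b]%classic = (G b - G a)%:E.
Proof.
move=> ab; rewrite /lebesgue_stieltjes_measure /measure_extension.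
by rewrite measurable_mu_extE/= ?wlength_itv_bnd//; exact: is_ocitv.
Qed.

(** This is a node: the left endpoint of the [i]-th of [m] equal cells. The cells are taken open on
    the left and closed on the right, like the intervals on which a Stieltjes measure is
    explicit. *)
Definition cell a b m (i : nat) : R := a + i%:R * ((b - a) / m%:R).

Lemma cell_mono a b m i j : a <= b -> (i <= j)%N -> cell a b m i <= cell a b m j.
Proof.
move=> ab ij; rewrite lerD2l ler_wpM2r ?ler_nat//.
by rewrite divr_ge0// subr_ge0.
Qed.

Lemma cell0 a b m : cell a b m 0 = a.
Proof. by rewrite /cell mul0r addr0. Qed.

Lemma cell_last a b m : (0 < m)%N -> cell a b m m = b.
Proof.
by move=> m0; rewrite /cell mulrC divfK ?pnatr_eq0 -?lt0n// addrC subrK.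
Qed.

Lemma cell_cover a b m x : (0 < m)%N -> a < x -> x <= b ->
  exists i : 'I_m, cell a b m i < x <= cell a b m i.+1.
Proof.
move=> m0 ax xb.
have ex : exists k, x <= cell a b m k by exists m; rewrite cell_last.
have [k xk kmin] := ex_minnP ex.
have k0 : (0 < k)%N.
  by case: k xk {kmin} => //; rewrite cell0 => /(lt_le_trans ax); rewrite ltxx.
have km : (k.-1 < m)%N by rewrite prednK// kmin// cell_last.
exists (Ordinal km) => /=; rewrite prednK// xk andbT ltNge.
by apply/negP => /kmin; rewrite -ltnS prednK// ltnn.
Qed.

(* Let [U] be an open set of small measure containing [E]. By absolute continuity
   the cells contained in [U] of a regular subdivision have Stieltjes measure at
   most [e] in total; every point of [E] lies in such a cell for all fine enough
   subdivisions, so continuity from below gives the bound [e] for [E]. *)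
Lemma stieltjes_abs_cont (G : cumulative R R) a b (E : set R) : a < b ->
  abs_cont a b G -> measurable E -> mu E = 0%E ->
  lebesgue_stieltjes_measure G (E `&` `]a, b]) = 0%E.
Proof.
move=> ab acG mE E0; apply/eqP; rewrite -measure_le0; apply/lee_addgt0Pr => e e0.
rewrite add0e; have ab' := ltW ab.
have [d d0 dP] := acG _ e0.
have [U [oU EU UEd]] : exists U : set R, [/\ open U , E `<=` U & (mu (U `\` E) < d%:E)%E].
  have Eoo : (mu E < +oo)%E by rewrite E0 ltry.
  exact: lebesgue_regularity_outer mE Eoo d0.
have mU : measurable U by exact: open_measurable.
have Ud : (mu U < d%:E)%E.
  apply: le_lt_trans UEd.
  have := measureU2 mu mE (measurableD mU mE).
  by rewrite /= (setDUK EU) E0 add0e.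
pose p m (i : 'I_m) := cell a b m i.
(* A cell not contained in [U] is collapsed to an empty interval, so that the selected cells are
   still indexed by all of ['I_m]. *)
pose q m (i : 'I_m) := if `[< `]p m i, cell a b m i.+1] `<=` U >]
  then cell a b m i.+1 else p m i.
have pq m i : p m i <= q m i.
  by rewrite /q; case: asboolP => // _; exact: cell_mono.
have qS m i : q m i <= cell a b m i.+1.
  by rewrite /q; case: asboolP => // _; exact: cell_mono.
have ap m i : a <= p m i by rewrite -[leLHS](cell0 a b m); exact: cell_mono.
have qb m (i : 'I_m) : q m i <= b.
  apply: le_trans (qS m i) _; rewrite -[leRHS](@cell_last a b m)//.
  - exact: cell_mono.
  - exact: leq_ltn_trans (ltn_ord i).
have qp m (i j : 'I_m) : (i < j)%N -> q m i <= p m j.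
  by move=> ij; apply: le_trans (qS m i) _; exact: cell_mono.
pose V m := \big[setU/set0]_(i < m) `]p m i, q m i]%classic.
have VP m x : V m x <-> exists i, p m i < x <= q m i.
  rewrite /V -bigcup_seq; split=> [[i _ /=]|[i xi]]; first by rewrite in_itv/=; exists i.
  by exists i => /=; [rewrite mem_index_enum|rewrite in_itv].
have mV m : measurable (V m) by exact: bigsetU_measurable.
have tV m : trivIset setT (fun i => `]p m i, q m i]%classic).
  move=> i j _ _ [x []] /=; rewrite !in_itv/= => /andP[pix xqi] /andP[pjx xqj].
  apply/val_inj; case: (ltngtP (val i) (val j)) => // /qp.
  - by move/(le_trans xqi)/le_lt_trans => /(_ _ pjx); rewrite ltxx.
  - by move/(le_trans xqj)/le_lt_trans => /(_ _ pix); rewrite ltxx.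
have VU m : V m `<=` U.
  move=> x /VP[i]; rewrite /q; case: asboolP => [+ xi|_]; last first.
    by move=> /andP[/lt_le_trans h /h]; rewrite ltxx.
  by apply; rewrite /= in_itv.
have Ve m : (lebesgue_stieltjes_measure G (V m) <= e%:E)%E.
  rewrite /V measure_bigsetU_ord//.
  rewrite (eq_bigr (fun i => (G (q m i) - G (p m i))%:E)); last first.
    by move=> i _; exact: stieltjes_itv_oc.
  rewrite sumEFin lee_fin; apply: ltW.
  rewrite (eq_bigr (fun i => `|G (q m i) - G (p m i)|)); last first.
    by move=> i _; rewrite ger0_norm// subr_ge0; apply: cumulative_is_nondecreasing.
  have tpq : trivIset setT (fun i : 'I_m => `]p m i, q m i[%classic).
    by apply: trivIset_itv_ord => i j; exact: qp.
  apply: dP tpq _ => //.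
  rewrite -lte_fin; apply: le_lt_trans Ud.
  apply: (@le_trans _ _ (mu (V m))); last exact: (le_measure mu (mem_set (mV m)) (mem_set mU) (@VU m)).
  rewrite /V measure_bigsetU_ord// -sumEFin; apply: lee_sum => i _.
  rewrite /= lebesgue_measure_itv/= lte_fin; case: ltP => //.
  by move=> /(conj (pq m i))/andP/le_anti ->; rewrite subrr.
(* Equal subdivisions for successive [m] do not refine each other, so [V] need not be monotone. The
   tail intersections [B] increase, lie in the [V n], and still cover [E]. *)
pose B n := \bigcap_(m in [set m | (n <= m)%N]) V m.
have mB n : measurable (B n) by apply: bigcap_measurable => //; exists n => /=.
have EB : E `&` `]a, b] `<=` \bigcup_n B n.
  move=> x [/EU Ux] /=; rewrite in_itv/= => /andP[ax xb].
  have /nbhs_ballP[r /= r0 xrU] : nbhs x U by exact: open_nbhs_nbhs.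
  (* From this index on the cells are narrower than [r], so the cell containing [x] stays in the
     ball of radius [r] around [x], hence in [U]. *)
  exists (Num.truncn ((b - a) / r)).+1; first by [].
  rewrite /B /= => m km.
  have m0 : (0 < m)%N by exact: leq_ltn_trans km.
  have mr : (b - a) / m%:R < r.
    rewrite ltr_pdivrMr ?ltr0n// mulrC -ltr_pdivrMr//.
    by apply: lt_le_trans (truncnS_gt _) _; rewrite ler_nat.
  have [i /andP[ix xi]] := cell_cover m0 ax xb.
  apply/VP; exists i.
  rewrite /q asboolT ?in_itv/= ?ix ?xi// => y /=; rewrite in_itv/= => /andP[iy yi].
  apply: xrU; rewrite /ball/= ltr_norml; move: ix iy xi yi.
  by rewrite /p /cell -natr1 [(_ + 1) * _]mulrDl mul1r; lra.
apply: (@le_trans _ _ (lebesgue_stieltjes_measure G (\bigcup_n B n))).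
  apply: le_measure => //; rewrite inE; first exact: measurableI.
  exact: bigcupT_measurable.
have BS n n' : (n <= n')%N -> B n `<=` B n'.
  by move=> nn' x Bx m /= n'm; apply: Bx => /=; exact: leq_trans n'm.
have : lebesgue_stieltjes_measure G \o B @ \oo --> lebesgue_stieltjes_measure G (\bigcup_n B n).
  apply: nondecreasing_cvg_mu => //; first exact: bigcupT_measurable.
  by move=> n n' nn'; apply/subsetPset; exact: BS.
move=> /cvg_lim <-//; apply: lime_le.
  apply: ereal_nondecreasing_is_cvgn => n n' nn'.
  exact: (le_measure (lebesgue_stieltjes_measure G) (mem_set (mB n)) (mem_set (mB n')) (BS _ _ nn')).
apply: nearW => n; apply: le_trans (Ve n).
apply: (le_measure (lebesgue_stieltjes_measure G) (mem_set (mB n)) (mem_set (mV n))).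
by move=> x; apply => /=.
Qed.

Lemma monotone_abs_cont_integral a b F : a < b ->
  {in `[a, b] &, {homo F : x y / x <= y}} -> abs_cont a b F ->
  exists2 g : R -> R, mu.-integrable setT (EFin \o g) &
    forall x, a <= x <= b -> F x - F a = \int[mu]_(t in `]a, x]) g t.
Proof.
move=> ab ndF acF; have [G GF] := cumulative_extension (ltW ab) ndF acF.
have acG : abs_cont a b G.
  move=> e /acF[d d0 dP]; exists d => // m p q pq tpq sd.
  rewrite (eq_bigr (fun i => `|F (q i) - F (p i)|)); first exact: dP.
  move=> i _; have [ap [piq qb]] := pq i.
  by rewrite !GF// in_itv/= ?ap ?qb ?andbT// (le_trans ap, le_trans piq).
have mD : measurable (`]a, b]%classic : set (measurableTypeR R)).
  exact: measurable_itv.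
have foo : (lebesgue_stieltjes_measure G `]a, b]%classic < +oo)%E.
  by rewrite stieltjes_itv_oc ?ltry// ltW.
(* Restriction to []a, b]] supplies the finite measure to which Radon-Nikodym is applied. *)
pose nu : {finite_measure set (measurableTypeR R) -> \bar R} := mfrestr mD foo.
have numu : charge_of_finite_measure nu `<< mu.
  apply/null_content_dominatesP => E mE E0.
  exact: stieltjes_abs_cont.
pose rho := Radon_Nikodym (charge_of_finite_measure nu) mu.
have rhofin x : rho x \is a fin_num by exact: Radon_Nikodym_fin_num.
have rhoE : rho = EFin \o (fine \o rho).
  by apply/funext => x /=; rewrite fineK.
exists (fine \o rho).
  by rewrite -rhoE; exact: Radon_Nikodym_integrable.
move=> x /andP[ax xb].
have mx : measurable (`]a, x]%classic : set R) by exact: measurable_itv.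
have := Radon_Nikodym_integral numu mx.
rewrite /charge_of_finite_measure /= /mfrestr /mrestr.
rewrite (_ : _ `&` _ = `]a, x]%classic); last first.
  by apply/setIidl => y /=; rewrite !in_itv/= => /andP[-> yx]; exact: le_trans xb.
rewrite stieltjes_itv_oc// !GF ?in_itv/= ?lexx ?ax ?xb ?(ltW ab)//.
by rewrite -/rho {1}rhoE /Rintegral => <-.
Qed.

End monotone_abs_cont.

(** * The fundamental theorem of calculus for absolutely continuous functions *)

Section abs_cont_FTC.
Context {R : realType}.
Implicit Types (a b e : R) (f g : R -> R).
Local Notation mu := (@lebesgue_measure R).

(** Write [f] as [V - (V - f)] with [V] its variation function: both terms are nondecreasing, since
    an increment of [V] dominates the increment of [f] in absolute value, and both are absolutely
    continuous. *)
Lemma abs_cont_integral a b f : a < b -> abs_cont a b f ->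
  exists2 g : R -> R, mu.-integrable setT (EFin \o g) &
    forall x, a <= x <= b -> f x - f a = \int[mu]_(t in `]a, x]) g t.
Proof.
move=> ab acf; have bv := abs_cont_bounded_variation acf.
pose V x := fine (total_variation a x f).
have acV : abs_cont a b V by exact: abs_cont_total_variation.
have VB x y : x \in `[a, b] -> y \in `[a, b] -> x <= y ->
    V y - V x = fine (total_variation x y f) /\ `|f y - f x| <= V y - V x.
  rewrite !in_itv/= => /andP[ax xb] /andP[ay yb] xy.
  have bvy := bounded_variationl ay yb bv.
  rewrite /V total_variationB//; split => //.
  rewrite -lee_fin fineK ?total_variation_ge//.
  by apply/bounded_variationP => //; exact: bounded_variationr bvy.
have ndV : {in `[a, b] &, {homo V : x y / x <= y}}.
  move=> x y xab yab xy; have [_] := VB _ _ xab yab xy.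
  by move=> /(le_trans (normr_ge0 _)); rewrite subr_ge0.
have ndW : {in `[a, b] &, {homo V \- f : x y / x <= y}}.
  move=> x y xab yab xy /=; have [_] := VB _ _ xab yab xy.
  by move=> /(le_trans (ler_norm _)); lra.
have [g1 ig1 g1E] := monotone_abs_cont_integral ab ndV acV.
have [g2 ig2 g2E] := monotone_abs_cont_integral ab ndW (abs_contB acV acf).
exists (g1 \- g2).
  have -> : EFin \o (g1 \- g2) = ((EFin \o g1) \- (EFin \o g2))%E.
    by apply/funext.
  exact: integrableB.
move=> x xab; rewrite RintegralB//.
- by rewrite -g1E// -g2E//=; ring.
- by apply: integrableS ig1.
- by apply: integrableS ig2.
Qed.

(** Agreement is asked only near [x] because [f] equals the primitive [g] of its density on [[a, b]]
    alone. *)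
Lemma derive_onE (A : set R) f g (x : R) : nbhs x A ->
  (\forall y \near x, f y = g y) -> derivable g x 1 ->
  derive_on A f x = derive1 g x.
Proof.
move=> Ax fg dg; rewrite /derive_on.
have -> : within A x^' = x^'.
  apply/seteqP; split=> P; rewrite /within/= => H.
    by apply: filterS2 (nbhs_dnbhs Ax) H => y Ay; exact.
  by apply: filterS H.
apply: (cvg_lim (@Rhausdorff R)); apply/cvgrPdist_lt => e e0.
have /cvgrPdist_lt/(_ e e0) : (fun h => h^-1 *: ((g \o shift x) (h *: 1) - g x)) @ 0^' --> derive1 g x.
  by rewrite derive1E; exact: dg.
move=> /nbhs_ballP[r /= r0 H].
have fgx : f x = g x by exact: nbhs_singleton fg.
have : \forall y \near x^', y != x by exact: nbhs_dnbhs_neq.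
have : \forall y \near x^', ball x r y by apply: nbhs_dnbhs; exact: nbhsx_ballx.
move/nbhs_dnbhs: fg.
apply: filterS3 => y fgy xry yx.
have yx0 : y - x != 0 by rewrite subr_eq0.
have by0 : ball 0 r (y - x) by move: xry; rewrite /ball/= sub0r normrN distrC.
have := H _ by0 yx0; rewrite fgy fgx /shift/= -[(y - x) *: 1]/((y - x) * 1).
by rewrite mulr1 subrK -[_ *: _]/(_ * _) [_^-1 * _]mulrC.
Qed.

Lemma abs_cont_FTC a b f : a < b -> abs_cont a b f ->
  exists2 g : R -> R, mu.-integrable setT (EFin \o g) &
    (forall x, a <= x <= b -> f x = f a + \int[mu]_(t in `]a, x]) g t) /\
    derive_on `[a, b] f = g %[ae mu in `[a, b]%classic].
Proof.
move=> ab acf; have [g ig gE] := abs_cont_integral ab acf.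
exists g => //; split=> [x /gE <-|]; first by rewrite addrC subrK.
have int y : mu.-integrable [set` Interval (BRight a) (BRight y)] (EFin \o g).
  by apply: integrableS ig.
have locg : locally_integrable setT g.
  exact: open_integrable_locally openT ig.
(* At the endpoints the relative derivative is one-sided and the differentiation theorem does not
   reach it; they form a null set. *)
have endp : {ae mu, forall x, x != a /\ x != b}.
  exists ([set a] `|` [set b]); split.
  - exact: measurableU.
  - apply/eqP; rewrite -measure_le0; apply: le_trans (measureU2 mu _ _) _ => //.
    by rewrite /= !lebesgue_measure_set1 adde0.
  - by move=> x /= /not_andP[|] /negP/negPn/eqP; [left|right].
move: (FTC1 int locg) endp; apply: filterS2; first exact: (ae_filter_ringOfSetsType mu).
move=> x /= dx [xa xb].
rewrite in_itv/= !le_eqVlt (negbTE xb) eq_sym (negbTE xa)/= => /andP[ax xb'].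
have [|dg gx] := dx; first by [].
set F := fun x => \int[mu]_(t in `]a, x]) g t in dg gx.
rewrite -gx.
have dc := derivable_cst (f a) x 1.
have dF : derivable (cst (f a) + F) x 1 := derivableD dc dg.
rewrite (@derive_onE `[a, b] f (cst (f a) + F) x)//.
- by rewrite !derive1E (deriveD dc dg) derive_cst add0r.
- have xab : x \in `]a, b[ by rewrite in_itv/= ax.
  by apply: filterS (near_in_itvoo xab) => y; exact: subset_itv_oo_cc.
- near=> y; rewrite -[RHS]/(f a + F y) /F -gE; first by rewrite addrC subrK.
  by apply/andP; split; apply: ltW; near: y; [exact: lt_nbhsr|exact: lt_nbhsl].
Unshelve. all: by end_near. Qed.

End abs_cont_FTC.

(** * Affine changes of variables *)

Section affine_substitution.
Context {R : realType}.
Local Notation mu := (@lebesgue_measure R).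
Local Open Scope ereal_scope.

Lemma measurable_affine (c d : R) :
  measurable_fun [set: measurableTypeR R]
    ((fun x : R => c * x + d)%R : measurableTypeR R -> measurableTypeR R).
Proof. by apply: measurable_funD => //; apply: measurable_funM. Qed.

(** By uniqueness of Lebesgue measure it is enough to compare the scaled image measure with it on
    half-open intervals. Negative [c] is included for the sake of the reflections that exchange
    left-sided and right-sided integrals. *)
Lemma lebesgue_measure_affine (c d : R) (A : set R) : (c != 0)%R -> measurable A ->
  mu A = `|c|%:E * mu ((fun x => c * x + d)%R @^-1` A).
Proof.
move=> c0 mA; pose phi : measurableTypeR R -> measurableTypeR R := fun x : R => (c * x + d)%R.
have mphi : measurable_fun setT phi := measurable_affine c d.
pose m : {measure set (measurableTypeR R) -> \bar R} :=
  mscale (NngNum (normr_ge0 c)) (pushforward mu phi).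
suff -> : mu A = m mphi A by [].
apply: lebesgue_measure_unique => // _ [[p q] _ <-] /=.
rewrite /m /mscale/= /pushforward.
have [pq|qp] := ltP p q; last first.
  by rewrite set_itv_ge ?preimage_set0 ?measure0 ?mule0// bnd_simp -leNgt.
have [c0'|c0'] : (c < 0)%R \/ (0 < c)%R by apply/orP; rewrite -neq_lt.
- rewrite (_ : _ @^-1` _ = `[(q - d) / c, (p - d) / c[%classic)%R; last first.
    apply/seteqP; split=> x /=; rewrite /phi !in_itv/= ler_ndivrMr// ltr_ndivlMr//;
      move=> /andP[h1 h2]; apply/andP; split; lra.
  rewrite !lebesgue_measure_itv/= !lte_fin pq ltr_ndivrMr// divfK//.
  rewrite ltrD2r pq -!EFinD -EFinM ltr0_norm//; congr EFin.
  by field.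
- rewrite (_ : _ @^-1` _ = `](p - d) / c, (q - d) / c]%classic)%R; last first.
    apply/seteqP; split=> x /=; rewrite /phi !in_itv/= ltr_pdivrMr// ler_pdivlMr//;
      move=> /andP[h1 h2]; apply/andP; split; lra.
  rewrite !lebesgue_measure_itv/= !lte_fin pq ltr_pdivrMr// divfK//.
  rewrite ltrD2r pq -!EFinD -EFinM gtr0_norm//; congr EFin.
  by field.
Qed.

Lemma ge0_integral_affine (c d : R) (f : R -> \bar R) : (c != 0)%R ->
  measurable_fun setT f -> (forall x, 0 <= f x) ->
  \int[mu]_x f x = `|c|%:E * \int[mu]_x f (c * x + d)%R.
Proof.
move=> c0 mf f0; pose phi : measurableTypeR R -> measurableTypeR R := fun x : R => (c * x + d)%R.
have mphi : measurable_fun setT phi := measurable_affine c d.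
pose m : {measure set (measurableTypeR R) -> \bar R} :=
  mscale (NngNum (normr_ge0 c)) (pushforward mu phi).
rewrite (@eq_measure_integral _ _ _ _ (m mphi))/=; last first.
  by move=> A mA _; rewrite (lebesgue_measure_affine d c0 mA).
rewrite ge0_integral_mscale//=; congr (_ * _).
by rewrite (ge0_integral_pushforward mphi).
Qed.

Lemma integral_affine (c d : R) (f : R -> \bar R) : (c != 0)%R ->
  measurable_fun setT f ->
  \int[mu]_x f x = `|c|%:E * \int[mu]_x f (c * x + d)%R.
Proof.
move=> c0 mf; rewrite integralE [X in _ = _ * X]integralE.
rewrite (ge0_integral_affine d c0 (measurable_funepos mf))//.
rewrite (ge0_integral_affine d c0 (measurable_funeneg mf))//.
have k0 : (0 < `|c|)%R by rewrite normr_gt0.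
(* The integrals of the two parts may be infinite, so distributivity of the positive factor is
   checked case by case. *)
have mulB (x y : \bar R) : `|c|%:E * (x - y) = `|c|%:E * x - `|c|%:E * y.
  by case: x => [x||]; case: y => [y||] //=;
    rewrite -?EFinB -?EFinM ?mulrBr ?gt0_muley ?gt0_muleNy ?lte_fin.
rewrite -mulB; congr (_ * (_ - _)); apply: eq_integral => x _.
- by rewrite !funeposE.
- by rewrite !funenegE.
Qed.

Lemma Rintegral_itv_oppr (a b : R) (f : R -> R) :
  measurable_fun `]a, b[ f ->
  (\int[mu]_(x in `]a, b[) f x = \int[mu]_(x in `](- b), (- a)[) f (- x))%R.
Proof.
move=> mf; rewrite /Rintegral integral_mkcond [in RHS]integral_mkcond.
rewrite (@integral_affine (-1) 0)//; last first.
  by apply/(measurable_restrictT _ _).1 => //; exact/measurable_EFinP.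
rewrite normrN1 mul1e; congr fine; apply: eq_integral => x _.
rewrite mulN1r addr0 !patchE !mem_setE !in_itv/=.
by rewrite [(a < - x)%R]ltrNr [(- x < b)%R]ltrNl andbC.
Qed.

End affine_substitution.

(** * The power kernel and its integral near the singularity *)

Section power_kernel.
Context {R : realType}.
Local Notation mu := (@lebesgue_measure R).
Implicit Types a b x y t : R.

(** Extension by zero turns integrals over intervals into convolutions over the whole line, where
    substitutions and exchanges have no bounds to track. The exponent is that of the Gamma
    integral. *)
Definition powk a t : R := if 0 < t then t `^ (a - 1) else 0.

Lemma powk_ge0 a t : 0 <= powk a t.
Proof. by rewrite /powk; case: ifP => // _; exact: powR_ge0. Qed.

Lemma powkE a t : 0 < t -> powk a t = t `^ (a - 1).
Proof. by rewrite /powk => ->. Qed.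

Lemma powk_le0 a t : t <= 0 -> powk a t = 0.
Proof. by rewrite /powk; case: ltP. Qed.

Lemma measurable_powk a : measurable_fun setT (powk a).
Proof.
by apply: measurable_fun_ifT => //; exact: measurable_fun_ltr.
Qed.

Lemma powkM a x y : 0 < x -> powk a (x * y) = x `^ (a - 1) * powk a y.
Proof.
move=> x0; rewrite /powk pmulr_rgt0//; case: ltP => y0; last by rewrite mulr0.
by rewrite powRM// ltW.
Qed.

Lemma integral_powk1 a : 0 < a ->
  (\int[mu]_(t in `]0%R, 1%R[) (powk a t)%:E = (a^-1)%:E)%E.
Proof.
move=> a0.
have mk := measurable_powk a.
transitivity (\int[mu]_(t in `]0%R, 1%R]) (powk a t)%:E)%E.
  rewrite integral_itv_bndo_bndc//.
  by apply/measurable_EFinP; exact: measurable_funTS.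
(* For [a < 1] the kernel is unbounded at 0, so the primitive is used on intervals away from 0 and
   monotone convergence gives the rest. The shift by two makes every left endpoint strictly less
   than 1. *)
pose F n : set R := `[n.+2%:R^-1, 1%R]%classic.
have FE : `]0%R, 1%R]%classic = \bigcup_n F n.
  apply/seteqP; split=> x /=.
  - rewrite in_itv/= => /andP[x0 x1]; exists (Num.truncn x^-1) => //.
    rewrite /F /= in_itv/= x1 andbT invf_ple ?posrE//.
    apply/ltW/(lt_trans (truncnS_gt _)); by rewrite ltr_nat.
  - move=> [n _]; rewrite /F /= !in_itv/= => /andP[nx ->]; rewrite andbT.
    by apply: lt_le_trans nx.
have : (\int[mu]_(t in F i) (powk a t)%:E @[i --> \oo] -->
        \int[mu]_(t in \bigcup_i F i) (powk a t)%:E)%E.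
  apply: ge0_nondecreasing_set_cvg_integral.
  - move=> n m nm; apply/subsetPset; apply: subset_itvr; rewrite bnd_simp.
    by rewrite lef_pV2 ?posrE// ler_nat.
  - by move=> i; exact: measurable_itv.
  - by move=> i; apply/measurable_EFinP; exact: measurable_funTS.
  - by move=> i x _; rewrite lee_fin powk_ge0.
rewrite FE => /cvg_lim <- //; apply/cvg_lim => //.
have Fn n : (\int[mu]_(t in F n) (powk a t)%:E =
    (a^-1 - a^-1 * n.+2%:R^-1 `^ a)%:E)%E.
  have n0 : (0 : R) < n.+2%:R^-1 by rewrite invr_gt0.
  rewrite (_ : (a^-1 - _)%:E = (a^-1 * 1 `^ a)%:E - (a^-1 * n.+2%:R^-1 `^ a)%:E)%E; last first.
    by rewrite powR1 mulr1.
  have cpow x : 0 < x -> {for x, continuous (fun t : R => t `^ a)}.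
    move=> x0; apply: differentiable_continuous; apply/derivable1_diffP.
    by have [] := is_derive1_powR a x0.
  have cpow1 x : 0 < x -> {for x, continuous (fun t : R => t `^ (a - 1))}.
    move=> x0; apply: differentiable_continuous; apply/derivable1_diffP.
    by have [] := is_derive1_powR (a - 1) x0.
  have dF x : 0 < x -> is_derive x 1 (fun t : R => a^-1 * t `^ a) (x `^ (a - 1)).
    move=> x0; have dx := is_derive1_powR a x0.
    apply: is_derive_eq.
    by rewrite -[_ *: _]/(_ * _) mulrA mulVf ?mul1r// gt_eqF.
  apply: (@continuous_FTC2 R (powk a) (fun t => a^-1 * t `^ a)).
  - by rewrite invf_lt1// ltr1n.
  - apply: (@subspace_eq_continuous _ _ _ (fun t : R => t `^ (a - 1))).
      move=> x; rewrite inE/= in_itv/= => /andP[nx _].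
      by rewrite /= [RHS]powkE//; exact: lt_le_trans nx.
    apply: continuous_in_subspaceT => x; rewrite inE/= in_itv/= => /andP[nx _].
    by apply: cpow1; exact: lt_le_trans nx.
  - split.
    + move=> x; rewrite in_itv/= => /andP[nx _].
      by have [] := dF _ (lt_trans n0 nx).
    + apply: cvg_at_right_filter; apply: cvgM; first exact: cvg_cst.
      exact: cpow.
    + apply: cvg_at_left_filter; apply: cvgM; first exact: cvg_cst.
      exact: cpow.
  - move=> x; rewrite in_itv/= => /andP[nx _].
    have x0 := lt_trans n0 nx.
    by rewrite powkE// derive1E; have [_ ->] := dF _ x0.
under eq_fun do rewrite Fn.
apply: cvg_EFin; first by apply: nearW.
have cvgh := @cvg_harmonic R.
have h : a^-1 - a^-1 * n.+2%:R^-1 `^ a @[n --> \oo] --> a^-1 - a^-1 * 0.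
  apply: cvgB; first exact: cvg_cst.
  apply: cvgM; first exact: cvg_cst.
  have /cvg_at_rightP H := powR_cvg0 a0; apply: (H (fun n => n.+2%:R^-1)).
  split; first by move=> n; rewrite invr_gt0.
  by rewrite -(cvg_shiftS (@harmonic R)) in cvgh.
by rewrite mulr0 subr0 in h.
Qed.

End power_kernel.

(** * The Gamma function and the Gamma-Beta relation *)

Section gamma_function.
Context {R : realType}.
Local Notation mu := (@lebesgue_measure R).
Implicit Types a b x y t : R.
Local Open Scope ereal_scope.

(** The convolution of two power kernels; at [x = 1] it is Euler's Beta function. Extended real
    values allow identities to be established ahead of finiteness. *)
Definition betaI a b x : \bar R := \int[mu]_s (powk a s * powk b (x - s))%:E.

Definition gammaI a : \bar R := \int[mu]_t (powk a t * expR (- t))%:E.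

Lemma powk_expR_ge0 a t : (0 <= powk a t * expR (- t))%R.
Proof. by rewrite mulr_ge0 ?powk_ge0// expR_ge0. Qed.

Lemma gammaI_ge0 a : 0 <= gammaI a.
Proof. by apply: integral_ge0 => t _; rewrite lee_fin powk_expR_ge0. Qed.

Lemma betaI_ge0 a b x : 0 <= betaI a b x.
Proof. by apply: integral_ge0 => t _; rewrite lee_fin mulr_ge0 ?powk_ge0. Qed.

Lemma GammaE a : Gamma a = fine (gammaI a).
Proof.
rewrite /Gamma /Rintegral /gammaI integral_mkcond; congr fine.
apply: eq_integral => t _; rewrite patchE mem_setE in_itv/= andbT /powk.
by case: ifP => //; rewrite mul0r.
Qed.

Lemma measurable_betaI a b x :
  measurable_fun setT (fun s => powk a s * powk b (x - s))%R.
Proof.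
apply: measurable_funM; first exact: measurable_powk.
apply: (measurableT_comp (measurable_powk b)).
exact: measurable_funB.
Qed.

Lemma measurable_gammaI a : measurable_fun setT (fun t => powk a t * expR (- t))%R.
Proof.
apply: measurable_funM; first exact: measurable_powk.
by apply: measurableT_comp => //; exact: measurable_expR.
Qed.

Lemma betaI_le0 a b x : (x <= 0)%R -> betaI a b x = 0.
Proof.
move=> x0; rewrite /betaI; apply: integral0_eq => s _; congr EFin.
have [s0|s0] := leP s 0%R; first by rewrite powk_le0// mul0r.
by rewrite [X in (_ * X)%R]powk_le0 ?mulr0//; lra.
Qed.

Lemma betaI_homo a b x : (0 < x)%R ->
  betaI a b x = (x `^ (a + b - 1))%:E * betaI a b 1.
Proof.
move=> x0; pose f s := (powk a s * powk b (x - s))%:E.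
pose g s := (powk a s * powk b (1 - s))%:E.
have f0 s : 0 <= f s by rewrite lee_fin mulr_ge0 ?powk_ge0.
have g0 s : setT s -> 0 <= g s by rewrite lee_fin mulr_ge0 ?powk_ge0.
have mf : measurable_fun setT f by apply/measurable_EFinP; exact: measurable_betaI.
have mg : measurable_fun setT g by apply/measurable_EFinP; exact: measurable_betaI.
have xr0 : 0 <= (x `^ (a + b - 1))%:E by rewrite lee_fin powR_ge0.
have -> : betaI a b x = \int[mu]_s (`|x|%:E * f (x * s + 0)%R).
  have mf' := measurableT_comp mf (measurable_affine x 0).
  rewrite (@ge0_integralZl _ _ R mu setT measurableT _ mf' _ (fun s _ => f0 _)) ?lee_fin//.
  by apply: ge0_integral_affine => //; rewrite gt_eqF.
have -> : betaI a b 1 = \int[mu]_s g s by [].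
rewrite -(@ge0_integralZl _ _ R mu setT measurableT _ mg _ g0 xr0).
apply: eq_integral => s _; rewrite /f /g -!EFinM gtr0_norm// addr0; congr EFin.
rewrite -[(x - x * s)%R](_ : x * (1 - s) = _)%R; last by ring.
have xn0 : (x != 0)%R by rewrite gt_eqF.
have -> : (x `^ (a + b - 1) = x * (x `^ (a - 1) * x `^ (b - 1)))%R.
  rewrite -powRD ?xn0 ?implybT// -[X in (X * _)%R]powRr1 ?ltW//.
  by rewrite -powRD ?xn0 ?implybT//; congr (_ `^ _)%R; ring.
by rewrite !powkM//; ring.
Qed.

(** Substitute [r - s] in the second Gamma integral and exchange by Tonelli. The exponentials
    combine to [expR (- r)], the inner integral is [betaI a b r], and its homogeneity leaves the
    integrand of [gammaI (a + b)]. *)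
Lemma gammaI_mul a b : gammaI a * gammaI b = gammaI (a + b) * betaI a b 1.
Proof.
pose f (s r : R) := (powk a s * expR (- s) * (powk b (r - s) * expR (- (r - s))))%R.
have f0 s r : (0 <= f s r)%R by rewrite mulr_ge0// powk_expR_ge0.
have mf : measurable_fun setT (fun z : R * R => (f z.1 z.2)%:E).
  apply/measurable_EFinP; apply: measurable_funM.
    exact: measurableT_comp (measurable_gammaI a) measurable_fst.
  apply: (measurableT_comp (measurable_gammaI b)).
  exact: measurable_funB.
pose G c t := (powk c t * expR (- t))%:E.
have mG c : measurable_fun setT (G c).
  by apply/measurable_EFinP; exact: measurable_gammaI.
have G0 c t : setT t -> 0 <= G c t by rewrite lee_fin powk_expR_ge0.
transitivity (\int[mu]_s \int[mu]_r (f s r)%:E).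
  rewrite muleC -(@ge0_integralZl _ _ R mu setT measurableT _ (mG a) _ (G0 a) (gammaI_ge0 b)).
  apply: eq_integral => s _; rewrite muleC.
  rewrite /gammaI (@ge0_integral_affine _ 1 (- s) (G b))//; last by move=> t; exact: G0.
  have mGb := measurableT_comp (mG b) (measurable_affine 1 (- s)).
  have Gs0 : 0 <= (powk a s * expR (- s))%:E by rewrite lee_fin powk_expR_ge0.
  rewrite normr1 mul1e -(@ge0_integralZl _ _ R mu setT measurableT _ mGb _ (fun t _ => G0 b _ Logic.I) Gs0).
  by apply: eq_integral => r _; rewrite /= mul1r -EFinM.
transitivity (\int[mu]_r \int[mu]_s (f s r)%:E).
  have F0 (z : R * R) : 0 <= (f z.1 z.2)%:E by rewrite lee_fin.
  exact: (@fubini_tonelli _ _ _ _ R mu mu (fun z : R * R => (f z.1 z.2)%:E) mf F0).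
transitivity (\int[mu]_r ((expR (- r))%:E * betaI a b r)).
  have mB r : measurable_fun setT (fun s => (powk a s * powk b (r - s))%:E).
    by apply/measurable_EFinP; exact: measurable_betaI.
  have B0 r s : setT s -> 0 <= (powk a s * powk b (r - s))%:E.
    by rewrite lee_fin mulr_ge0 ?powk_ge0.
  have e0 r : 0 <= (expR (- r))%:E :> \bar R by rewrite lee_fin expR_ge0.
  apply: eq_integral => r _; rewrite -(@ge0_integralZl _ _ R mu setT measurableT _ (mB r) _ (B0 r) (e0 r)).
  apply: eq_integral => s _; rewrite -EFinM; congr EFin; rewrite /f.
  rewrite (_ : (- r = - s + - (r - s))%R) ?expRD; last by ring.
  by ring.
rewrite muleC -(@ge0_integralZl _ _ R mu setT measurableT _ (mG _) _ (G0 _) (betaI_ge0 a b 1)).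
apply: eq_integral => r _; rewrite /G; have [r0|r0] := leP r 0%R.
  by rewrite betaI_le0// powk_le0// mul0r !mule0.
by rewrite betaI_homo// powkE// mulrC EFinM muleA muleC.
Qed.

Lemma gammaI1 : gammaI 1 = 1.
Proof.
rewrite -(@integral_exponential_pdf R 1 ltr01) /gammaI.
have := @lebesgue_measure_set1 R 0%R => m0.
apply: ae_eq_integral => //.
- by apply/measurable_EFinP; exact: measurable_gammaI.
- by apply/measurable_EFinP; exact: measurable_exponential_pdf.
(* At 0 the kernel is 0 while the exponential density is 1; elsewhere they agree. *)
exists [set 0%R]; split => // t /= /not_implyP[_] h.
apply: contrapT => /eqP t0; apply: h.
rewrite /powk /exponential_pdf patchE mem_setE in_itv/= andbT lt_neqAle eq_sym t0/=.
by case: ifP; rewrite ?mul0r// subrr powRr0 mulN1r.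
Qed.

Lemma betaI11 a : (0 < a)%R -> betaI a 1 1 = (a^-1)%:E.
Proof.
move=> a0; rewrite -integral_powk1// integral_mkcond; apply: eq_integral => s _.
rewrite patchE mem_setE in_itv/=; case: ifPn => [/andP[s0 s1]|].
  by rewrite [X in (_ * X)%R]powkE ?subr_gt0// subrr powRr0 mulr1.
rewrite negb_and -!leNgt => /orP[s0|s1]; first by rewrite powk_le0// mul0r.
by rewrite [X in (_ * X)%R]powk_le0 ?mulr0// subr_le0.
Qed.

(** This is the Gamma-Beta relation at [b = 1], where the Beta integral is [a^-1]. It holds between
    extended reals and thereby serves to prove finiteness. *)
Lemma gammaIS a : (0 < a)%R -> gammaI (a + 1) = a%:E * gammaI a.
Proof.
move=> a0; have := gammaI_mul a 1; rewrite gammaI1 mule1 betaI11// => ->.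
by rewrite muleCA -EFinM divff ?mule1// gt_eqF.
Qed.

(** For exponents between 1 and 2 the kernel is dominated by the sum of the kernels for 1 and 2,
    whose Gamma integrals are known. The functional equation carries finiteness up to all larger
    arguments, then from [a + 1] down to [a]. *)
Lemma gammaI_fin a : (0 < a)%R -> gammaI a \is a fin_num.
Proof.
have fin12 c : (1 <= c <= 2)%R -> gammaI c \is a fin_num.
  move=> /andP[c1 c2]; rewrite ge0_fin_numE ?gammaI_ge0//.
  apply: (@le_lt_trans _ _ (gammaI 1 + gammaI 2)); last first.
    by rewrite -[2%R]/(1 + 1)%R gammaIS// gammaI1 mule1 -EFinD ltry.
  rewrite -ge0_integralD//; last 4 first.
  - by move=> t _; rewrite lee_fin powk_expR_ge0.
  - by apply/measurable_EFinP; exact: measurable_gammaI.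
  - by move=> t _; rewrite lee_fin powk_expR_ge0.
  - by apply/measurable_EFinP; exact: measurable_gammaI.
  apply: ge0_le_integral => //.
  - by move=> t _; rewrite lee_fin powk_expR_ge0.
  - by apply/measurable_EFinP; exact: measurable_gammaI.
  - by apply: emeasurable_funD; apply/measurable_EFinP; exact: measurable_gammaI.
  move=> t _; rewrite -EFinD lee_fin -mulrDl ler_wpM2r ?expR_ge0//.
  have [t0|t0] := leP t 0%R; first by rewrite !powk_le0// addr0.
  rewrite !powkE// subrr powRr0; have [t1|t1] := leP t 1%R.
    apply: (@le_trans _ _ 1%R); last by rewrite lerDl powR_ge0.
    rewrite -[leRHS](congr1 (fun g => g (c - 1)%R) (powR1 R)); apply: ge0_ler_powR; rewrite ?nnegrE ?subr_ge0//.
    exact: ltW.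
  apply: (@le_trans _ _ (t `^ (2 - 1)))%R; last by rewrite lerDr.
  by apply: ler_powR; [exact: ltW|lra].
have finn n c : (1 <= c <= n.+2%:R)%R -> gammaI c \is a fin_num.
  elim: n c => [c|n ih c /andP[c1]]; first exact: fin12.
  have [cn _|cn cn'] := leP c 2%R; first by apply: fin12; rewrite c1.
  rewrite -(subrK 1%R c) gammaIS; last by lra.
  by rewrite fin_numM// ih//; rewrite -natr1 in cn'; lra.
move=> a0.
have : gammaI (a + 1) \is a fin_num.
  apply: (finn (Num.truncn a).+1); have := truncnS_gt a.
  by rewrite -!natr1; lra.
rewrite gammaIS// ge0_fin_numE; last by rewrite mule_ge0 ?gammaI_ge0// lee_fin ltW.
rewrite ge0_fin_numE ?gammaI_ge0//; case: (gammaI a) (gammaI_ge0 a) => // [r _ _|_].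
  by rewrite ltry.
by rewrite gt0_muley.
Qed.

Lemma Gamma_gt0 a : (0 < a)%R -> (0 < Gamma a)%R.
Proof.
move=> a0; rewrite GammaE fine_gt0//.
have := gammaI_fin a0; rewrite ge0_fin_numE ?gammaI_ge0// => ->; rewrite andbT.
apply: (@lt_le_trans _ _ (\int[mu]_(t in `]1%R, 2%R[) (2^-1 * expR (- 2))%:E)).
  rewrite integral_cst//= lebesgue_measure_itv/= lte_fin ltr1n -EFinB -EFinM lte_fin.
  by rewrite mulr_gt0// ?mulr_gt0 ?expR_gt0//; lra.
apply: (@le_trans _ _ (\int[mu]_(t in `]1%R, 2%R[) (powk a t * expR (- t))%:E)).
  apply: ge0_le_integral => //.
  - by apply/measurable_EFinP; apply: measurable_funTS; exact: measurable_gammaI.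
  move=> t /=; rewrite in_itv/= => /andP[t1 t2]; rewrite lee_fin; apply: ler_pM.
  - by rewrite invr_ge0.
  - exact: expR_ge0.
  - have t0 : (0 < t)%R by lra.
    rewrite powkE//; apply: (@le_trans _ _ (t `^ (- 1)))%R.
      by rewrite powR_inv1 ?(ltW t0)// lef_pV2 ?posrE// ltW.
    by apply: ler_powR; lra.
  - by rewrite ler_expR lerN2 ltW.
apply: ge0_subset_integral => //.
- by apply/measurable_EFinP; exact: measurable_gammaI.
- by move=> t _; rewrite lee_fin powk_expR_ge0.
Qed.

Lemma Gamma1 : Gamma 1 = 1%R :> R.
Proof. by rewrite GammaE gammaI1. Qed.

Lemma GammaS a : (0 < a)%R -> Gamma (a + 1) = (a * Gamma a)%R.
Proof. by move=> a0; rewrite !GammaE gammaIS// fineM// gammaI_fin. Qed.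

Lemma betaI_Gamma a b : (0 < a)%R -> (0 < b)%R ->
  betaI a b 1 = (Gamma a * Gamma b / Gamma (a + b))%:E.
Proof.
move=> a0 b0; have ab0 := addr_gt0 a0 b0.
have finE c : (0 < c)%R -> gammaI c = (Gamma c)%:E.
  by move=> c0; rewrite GammaE fineK// gammaI_fin.
have := gammaI_mul a b; rewrite (finE _ a0) (finE _ b0) (finE _ ab0).
have := Gamma_gt0 ab0; move: (Gamma _) (Gamma _) (Gamma _) => G A B G0.
case: (betaI a b 1) (betaI_ge0 a b 1) => [z _|_|//].
  by rewrite -!EFinM => -[->]; rewrite mulrAC divff ?mul1r// gt_eqF.
by rewrite gt0_muley// lte_fin.
Qed.

End gamma_function.

(** * Fractional integrals of sums of powers *)

Section fractional_integrals.
Context {R : realType}.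
Local Notation mu := (@lebesgue_measure R).
Implicit Types a b x y t : R.

Lemma powkN r t : 0 < t -> (t `^ (1 - r))^-1 = powk r t.
Proof. by move=> t0; rewrite powkE// -powRN opprB. Qed.

(** Substituting [b - y] for the variable of [betaI a r (b - x)] gives the left side; homogeneity
    then extracts the power of [b - x]. *)
Lemma integral_powk_right b a r x : 0 < a -> 0 < r -> x < b ->
  (\int[mu]_(y in `]x, b[) ((b - y) `^ (a - 1) / (y - x) `^ (1 - r))%:E =
   (Gamma a * Gamma r / Gamma (a + r) * (b - x) `^ (a + r - 1))%:E)%E.
Proof.
move=> a0 r0 xb; rewrite mulrC EFinM -betaI_Gamma// -betaI_homo ?subr_gt0//.
rewrite /betaI (@ge0_integral_affine _ (-1) b)//; last 2 first.
- by apply/measurable_EFinP; exact: measurable_betaI.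
- by move=> s; rewrite lee_fin mulr_ge0 ?powk_ge0.
rewrite normrN1 mul1e integral_mkcond; apply: eq_integral => y _.
rewrite patchE mem_setE in_itv/= (_ : -1 * y + b = b - y); last by ring.
have -> : b - x - (b - y) = y - x by ring.
case: ifPn => [/andP[xy yb]|]; first by rewrite powkN ?subr_gt0// (@powkE _ a) ?subr_gt0.
rewrite negb_and -!leNgt => /orP[yx|by'].
  by rewrite [X in _ * X]powk_le0 ?mulr0// subr_le0.
by rewrite powk_le0 ?mul0r// subr_le0.
Qed.

Lemma measurable_right_kernel b a r x :
  measurable_fun setT (fun y => (b - y) `^ a / (y - x) `^ r).
Proof.
apply: measurable_funM.
  by apply: (measurableT_comp (measurable_powR a)); exact: measurable_funB.
under eq_fun do rewrite -powRN.
by apply: (measurableT_comp (measurable_powR (- r))); exact: measurable_funB.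
Qed.

Lemma integrable_powk_right b a r x : 0 < a -> 0 < r -> x < b ->
  mu.-integrable `]x, b[ (fun y => ((b - y) `^ (a - 1) / (y - x) `^ (1 - r))%:E).
Proof.
move=> a0 r0 xb; apply/integrableP; split.
  by apply/measurable_EFinP; apply: measurable_funTS; exact: measurable_right_kernel.
under eq_integral => y _ do
  rewrite /= ger0_norm ?divr_ge0 ?powR_ge0//.
by rewrite integral_powk_right// ltry.
Qed.

(* The fractional integral of order [r] of [\sum_j c j * (1 - x) ^ j]. *)
Definition powsum (c : nat -> R) (N : nat) (r x : R) : R :=
  \sum_(j < N) c j * (j`!%:R / Gamma (j%:R + 1 + r)) * (1 - x) `^ (j%:R + r).

Definition power_kernel j s r x y : R := (1 - y) `^ (j%:R + s) / (y - x) `^ (1 - r).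

Lemma integrable_power_kernel j s r x : 0 <= s -> 0 < r -> x < 1 ->
  mu.-integrable `]x, 1[ (EFin \o power_kernel j s r x).
Proof.
move=> s0 r0 x1; have js0 : 0 < j%:R + 1 + s by rewrite ltr_wpDr// ltr_wpDl.
rewrite /power_kernel (_ : j%:R + s = j%:R + 1 + s - 1); last by ring.
exact: integrable_powk_right.
Qed.

Lemma Rintegral_power_kernel j s r x : 0 <= s -> 0 < r -> x < 1 ->
  \int[mu]_(y in `]x, 1[) power_kernel j s r x y =
  Gamma (j%:R + 1 + s) * Gamma r / Gamma (j%:R + 1 + (s + r)) *
  (1 - x) `^ (j%:R + (s + r)).
Proof.
move=> s0 r0 x1; have js0 : 0 < j%:R + 1 + s by rewrite ltr_wpDr// ltr_wpDl.
rewrite (_ : j%:R + 1 + (s + r) = j%:R + 1 + s + r); last by ring.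
rewrite (_ : j%:R + (s + r) = j%:R + 1 + s + r - 1); last by ring.
rewrite /Rintegral /power_kernel (_ : j%:R + s = j%:R + 1 + s - 1); last by ring.
by rewrite (integral_powk_right js0 r0 x1).
Qed.

Let powsumS c m s r x : (fun y => powsum c m.+1 s y / (y - x) `^ (1 - r)) =
  (fun y => powsum c m s y / (y - x) `^ (1 - r) +
            c m * (m`!%:R / Gamma (m%:R + 1 + s)) * power_kernel m s r x y).
Proof.
by apply/funext => y; rewrite /powsum big_ord_recr/= mulrDl -[X in _ + X]mulrA.
Qed.

Let integrable_scaled_power (k : R) j s r x : 0 <= s -> 0 < r -> x < 1 ->
  mu.-integrable `]x, 1[ (EFin \o (fun y => k * power_kernel j s r x y)).
Proof.
move=> s0 r0 x1.
rewrite (_ : _ \o _ = fun y => k%:E * (EFin \o power_kernel j s r x) y)%E//.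
by apply: integrableZl => //; exact: integrable_power_kernel.
Qed.

Let integrable_powsum c N s r x : 0 <= s -> 0 < r -> x < 1 ->
  mu.-integrable `]x, 1[ (EFin \o (fun y => powsum c N s y / (y - x) `^ (1 - r))).
Proof.
move=> s0 r0 x1; elim: N => [|N ih].
  rewrite (_ : (fun y => _) = cst 0); first exact: integrable0.
  by apply/funext => y; rewrite /powsum big_ord0 mul0r.
have iN := integrable_scaled_power (c N * (N`!%:R / Gamma (N%:R + 1 + s))) N s0 r0 x1.
by rewrite powsumS; exact: integrableD ih iN.
Qed.

(** The Beta integral multiplies the [j]-th power by [Gamma (j%:R + 1 + s) / Gamma (j%:R + 1 + (s +
    r))], which is exactly the change of the normalising factor in [powsum]. Iterated integrals thus
    have orders that add. *)
Lemma frac_int_right_powsum c N s r x : 0 <= s -> 0 < r -> x <= 1 ->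
  frac_int_right 1 r (powsum c N s) x = powsum c N (s + r) x.
Proof.
have alg (A B D k f P : R) : A != 0 -> B != 0 ->
    A^-1 * (k * (f / B) * (B * A / D * P)) = k * (f / D) * P.
  by move=> A0 B0; move: (D^-1) => D'; field; rewrite A0 B0.
move=> s0 r0 x1; rewrite /frac_int_right (gt_eqF r0).
move: x1; rewrite le_eqVlt => /predU1P[->|x1].
  rewrite set_itvoo0 Rintegral_set0 mulr0 /powsum big1// => j _.
  by rewrite subrr powR0 ?mulr0// gt_eqF// ltr_wpDl// ltr_wpDl.
elim: N => [|N ih].
  rewrite (_ : (fun y => _) = cst 0); last first.
    by apply/funext => y; rewrite /powsum big_ord0 mul0r.
  by rewrite /Rintegral integral0 mulr0 /powsum big_ord0.
have iN := integrable_power_kernel N s0 r0 x1.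
have ikN := integrable_scaled_power (c N * (N`!%:R / Gamma (N%:R + 1 + s))) N s0 r0 x1.
have Gr : Gamma r != 0 by rewrite gt_eqF// Gamma_gt0.
have GN : Gamma (N%:R + 1 + s) != 0.
  by rewrite gt_eqF// Gamma_gt0// ltr_wpDr// ltr_wpDl.
rewrite powsumS (RintegralD _ (integrable_powsum c N s0 r0 x1) ikN)// mulrDr ih.
rewrite [in RHS]/powsum big_ord_recr/=; congr (_ + _).
by rewrite (RintegralZl _ _ iN)// (Rintegral_power_kernel N s0 r0 x1) (alg _ _ _ _ _ _ Gr GN).
Qed.

Lemma frac_int_left_opp a r f x : measurable_fun `]a, x[ f ->
  frac_int_left a r f x = frac_int_right (- a) r (f \o -%R) (- x).
Proof.
move=> mf.
have mk : measurable_fun `]a, x[ (fun y => f y / (x - y) `^ (1 - r)).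
  apply: measurable_funM; first exact: mf.
  rewrite (_ : (fun _ => _) = fun y => (x - y) `^ (- (1 - r))); last first.
    by apply/funext => y; rewrite powRN.
  apply: measurable_funTS.
  by apply: (measurableT_comp (measurable_powR _)); exact: measurable_funB.
rewrite /frac_int_left /frac_int_right; case: eqP => _; first by rewrite /= opprK.
apply: (congr1 (fun z => _ * z)).
rewrite (Rintegral_itv_oppr mk).
by apply: eq_Rintegral => y _; rewrite /= !opprK addrC.
Qed.

End fractional_integrals.

(** * Exchange of fractional integrals by Fubini *)

Section fractional_fubini.
Context {R : realType}.
Local Notation mu := (@lebesgue_measure R).
Implicit Types (a b x y r : R) (f h : R -> R).

(** Only the product [c * k] is known to be integrable: in the exchange below [c] contains a value
    of one of the functions, and where it vanishes [k] may fail to be integrable. *)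
Lemma EFin_RintegralZl (c : R) (k : R -> R) :
  mu.-integrable setT (EFin \o (fun y => c * k y)) ->
  (c * \int[mu]_y k y)%:E = (\int[mu]_y (c * k y)%:E)%E.
Proof.
move=> ick; have [->|c0] := eqVneq c 0.
  by under eq_integral do rewrite mul0r; rewrite mul0r integral0.
have ik : mu.-integrable setT (EFin \o k).
  rewrite (_ : _ \o _ = fun y => (c^-1)%:E * (EFin \o (fun y => c * k y)%R) y)%E.
    by apply: integrableZl.
  by apply/funext => y /=; rewrite -EFinM mulKf.
rewrite -RintegralZl// /Rintegral fineK//.
exact: integrable_fin_num ick.
Qed.

(** The restrictions together with the vanishing of [powk] confine the support to the triangle
    [a < y < x < b], on which both iterated integrals are taken. *)
Definition frac_kernel a b r f h (x y : R) : R :=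
  (f \_ `]a, b[) y * (h \_ `]a, b[) x * powk r (x - y).

Lemma frac_int_left_powk a b r f x : 0 < r -> a < x < b ->
  frac_int_left a r f x = (Gamma r)^-1 *
    \int[mu]_y ((f \_ `]a, b[) y * powk r (x - y)).
Proof.
move=> r0 /andP[ax xb]; rewrite /frac_int_left gt_eqF//; congr (_ * _).
rewrite Rintegral_mkcond; apply: eq_Rintegral => y _.
rewrite !patchE !mem_setE !in_itv/=; case: ifPn => [/andP[ay yx]|].
  by rewrite ay (lt_trans yx xb)/= powkN// subr_gt0.
rewrite negb_and -!leNgt => /orP[ya|xy].
  by rewrite [a < y]ltNge ya mul0r.
by rewrite powk_le0 ?mulr0// subr_le0.
Qed.

Lemma frac_int_right_powk a b r h y : 0 < r -> a < y < b ->
  frac_int_right b r h y = (Gamma r)^-1 *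
    \int[mu]_x ((h \_ `]a, b[) x * powk r (x - y)).
Proof.
move=> r0 /andP[ay yb]; rewrite /frac_int_right gt_eqF//; congr (_ * _).
rewrite Rintegral_mkcond; apply: eq_Rintegral => x _.
rewrite !patchE !mem_setE !in_itv/=; case: ifPn => [/andP[yx xb]|].
  by rewrite xb (lt_trans ay yx)/= powkN// subr_gt0.
rewrite negb_and -!leNgt => /orP[xy|bx].
  by rewrite powk_le0 ?mulr0// subr_le0.
by rewrite [x < b]ltNge bx andbF mul0r.
Qed.

Lemma frac_fubini a b r f h : 0 < r ->
  (mu \x mu)%E.-integrable setT
    (fun z : R * R => (frac_kernel a b r f h z.1 z.2)%:E) ->
  \int[mu]_(x in `]a, b[) (frac_int_left a r f x * h x) =
  \int[mu]_(y in `]a, b[) (f y * frac_int_right b r h y).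
Proof.
move=> r0 iK0; pose K (z : R * R) := ((Gamma r)^-1 * frac_kernel a b r f h z.1 z.2)%:E.
have iK : (mu \x mu)%E.-integrable setT K.
  by apply: (integrableZl measurableT ((Gamma r)^-1) iK0).
(* The section of the kernel is integrable for almost every [x] only, and just there is the factor
   [h x / Gamma r] moved through the inner integral; hence an almost everywhere comparison. *)
have L : (\int[mu]_(x in `]a, b[) (frac_int_left a r f x * h x)%:E =
    \int[mu]_x fubini_F mu K x)%E.
  rewrite integral_mkcond; apply: integral_ae_nonmeasurable.
  have := ae_integrable1 iK; apply: filterS => x ix _; rewrite patchE mem_setE in_itv/=.
  have KE y : K (x, y) = ((Gamma r)^-1 * (h \_ `]a, b[) x *
      ((f \_ `]a, b[) y * powk r (x - y)))%:E.
    by rewrite /K /frac_kernel/=; congr EFin; ring.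
  have ix' : mu.-integrable setT (EFin \o (fun y => (Gamma r)^-1 * (h \_ `]a, b[) x *
      ((f \_ `]a, b[) y * powk r (x - y)))).
    by rewrite (_ : _ \o _ = fun y => K (x, y))//; apply/funext => y; rewrite KE.
  have -> : fubini_F mu K x = ((Gamma r)^-1 * (h \_ `]a, b[) x *
      \int[mu]_y ((f \_ `]a, b[) y * powk r (x - y)))%:E.
    by rewrite EFin_RintegralZl//; apply: eq_integral => y _; rewrite KE.
  rewrite mulrAC patchE mem_setE in_itv/=.
  case: ifPn => axb; last by rewrite mulr0.
  by rewrite (frac_int_left_powk _ r0 axb).
have Rt : (\int[mu]_(y in `]a, b[) (f y * frac_int_right b r h y)%:E =
    \int[mu]_y fubini_G mu K y)%E.
  rewrite integral_mkcond; apply: integral_ae_nonmeasurable.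
  have := ae_integrable2 iK; apply: filterS => y iy _; rewrite patchE mem_setE in_itv/=.
  have KE x : K (x, y) = ((Gamma r)^-1 * (f \_ `]a, b[) y *
      ((h \_ `]a, b[) x * powk r (x - y)))%:E.
    by rewrite /K /frac_kernel/=; congr EFin; ring.
  have iy' : mu.-integrable setT (EFin \o (fun x => (Gamma r)^-1 * (f \_ `]a, b[) y *
      ((h \_ `]a, b[) x * powk r (x - y)))).
    by rewrite (_ : _ \o _ = fun x => K (x, y))//; apply/funext => x; rewrite KE.
  have -> : fubini_G mu K y = ((Gamma r)^-1 * (f \_ `]a, b[) y *
      \int[mu]_x ((h \_ `]a, b[) x * powk r (x - y)))%:E.
    by rewrite EFin_RintegralZl//; apply: eq_integral => x _; rewrite KE.
  rewrite mulrAC patchE mem_setE in_itv/=.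
  case: ifPn => ayb; last by rewrite mulr0.
  by rewrite (frac_int_right_powk _ r0 ayb) mulrC.
have FG : (\int[mu]_x fubini_F mu K x = \int[mu]_y fubini_G mu K y)%E by exact: Fubini iK.
by rewrite /Rintegral; congr fine; exact: etrans L (etrans FG (esym Rt)).
Qed.

(* The kernel [powk r] truncated to the interval [[0, l]], so that it is integrable. *)
Definition powk_upto r (l t : R) : R := powk r t * powk 1 (l - t).

Lemma powk_upto_ge0 r l t : 0 <= powk_upto r l t.
Proof. by rewrite mulr_ge0 ?powk_ge0. Qed.

Lemma integral_powk_upto r l (c : R) : 0 < r -> 0 < l -> 0 <= c ->
  (\int[mu]_t (c * powk_upto r l t)%:E = (c * (l `^ r / r))%:E)%E.
Proof.
move=> r0 l0 c0; under eq_integral do rewrite EFinM.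
rewrite ge0_integralZl//; last 2 first.
- by apply/measurable_EFinP; exact: measurable_betaI.
- by move=> t _; rewrite lee_fin powk_upto_ge0.
by rewrite -/(betaI r 1 l) betaI_homo// betaI11// addrK -!EFinM.
Qed.

Lemma frac_kernel_le a b r f h x y :
  `|frac_kernel a b r f h x y| <=
  `|(f \_ `]a, b[) y| * `|(h \_ `]a, b[) x| * powk_upto r (b - a) (x - y).
Proof.
rewrite /frac_kernel !normrM [`|powk _ _|]ger0_norm ?powk_ge0//.
rewrite !patchE !mem_setE !in_itv/=.
case: ifPn => [/andP[ay yb]|]; last by rewrite normr0 !mul0r.
case: ifPn => [/andP[ax xb]|]; last by rewrite normr0 !mulr0 !mul0r.
rewrite /powk_upto [X in _ <= _ * (_ * X)]powkE ?subrr ?powRr0 ?mulr1//.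
by lra.
Qed.

Lemma measurable_frac_kernel a b r f h :
  measurable_fun `]a, b[ f -> measurable_fun `]a, b[ h ->
  measurable_fun setT (fun z : R * R => (frac_kernel a b r f h z.1 z.2)%:E).
Proof.
move=> mf mh.
have mF : measurable_fun setT (f \_ `]a, b[) by apply/(measurable_restrictT _ _).1.
have mH : measurable_fun setT (h \_ `]a, b[) by apply/(measurable_restrictT _ _).1.
apply/measurable_EFinP; apply: measurable_funM; first apply: measurable_funM.
- exact: measurableT_comp mF measurable_snd.
- exact: measurableT_comp mH measurable_fst.
- apply: (measurableT_comp (measurable_powk r)); exact: measurable_funB.
Qed.

Lemma restrict_norm_lty a b f : mu.-integrable `]a, b[ (EFin \o f) ->
  (\int[mu]_y `|((f \_ `]a, b[) y)%:E| < +oo)%E.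
Proof.
move=> /integrableP[_]; rewrite integral_mkcond; congr (_ < _)%E.
apply: eq_integral => y _; rewrite !patchE; case: ifP => //.
by rewrite abse0.
Qed.

Lemma integrable_frac_kernel_left a b r f h M : a < b -> 0 < r ->
  mu.-integrable `]a, b[ (EFin \o f) -> measurable_fun `]a, b[ h ->
  (forall x, a < x < b -> `|h x| <= M) ->
  (mu \x mu)%E.-integrable setT
    (fun z : R * R => (frac_kernel a b r f h z.1 z.2)%:E).
Proof.
move=> ab r0 intf mh hM.
have mf : measurable_fun `]a, b[ f.
  by apply/measurable_EFinP; case/integrableP: intf.
have M0 : 0 <= M.
  by apply: le_trans (normr_ge0 _) (hM ((a + b) / 2) _); lra.
have mK := measurable_frac_kernel r mf mh.
have mF : measurable_fun setT (f \_ `]a, b[) by apply/(measurable_restrictT _ _).1.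
have ba0 : 0 < b - a by rewrite subr_gt0.
apply: (@integrable21ltyP _ _ _ _ R mu mu _ mK).2.
set C := (M * ((b - a) `^ r / r)).
have C0 : 0 <= C by rewrite mulr_ge0// divr_ge0 ?powR_ge0// ltW.
apply: (@le_lt_trans _ _ (\int[mu]_y (C%:E * `|((f \_ `]a, b[) y)%:E|)%E)%E).
  apply: ge0_le_integral => //.
  - by move=> y _; exact: integral_ge0.
  - apply: (@measurable_fun_fubini_tonelli_G _ _ _ _ R mu
      (fun z : R * R => `|(frac_kernel a b r f h z.1 z.2)%:E|)%E) => //.
    exact: measurableT_comp mK.
  - by apply: emeasurable_funM => //; apply: measurableT_comp => //; exact/measurable_EFinP.
  move=> y _.
  have -> : (C%:E * `|((f \_ `]a, b[) y)%:E|)%E =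
      (\int[mu]_x (`|(f \_ `]a, b[) y| * M * powk_upto r (b - a) x)%:E)%E.
    by rewrite integral_powk_upto ?mulr_ge0// -EFinM /C; congr EFin; ring.
  rewrite (@ge0_integral_affine _ 1 (- y))//; last 2 first.
  - by apply/measurable_EFinP; apply: measurable_funM => //; exact: measurable_betaI.
  - by move=> x; rewrite lee_fin mulr_ge0 ?powk_upto_ge0// mulr_ge0.
  rewrite normr1 mul1e; apply: ge0_le_integral => //.
  - by apply: measurableT_comp => //; exact: (measurableT_comp mK (measurable_pair2 _)).
  - apply/measurable_EFinP; apply: measurable_funM => //.
    apply: (measurableT_comp (measurable_betaI r 1 (b - a))).
    exact: measurable_affine.
  move=> x _; rewrite /= lee_fin mul1r; apply: le_trans (frac_kernel_le _ _ _ _ _ _ _) _.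
  rewrite ler_wpM2r ?powk_upto_ge0// ler_wpM2l// patchE mem_setE in_itv/=.
  by case: ifPn => [/hM//|_]; rewrite normr0.
rewrite ge0_integralZl//; last by apply: measurableT_comp => //; exact/measurable_EFinP.
rewrite lte_mul_pinfty// ?lee_fin//; exact: restrict_norm_lty.
Qed.

(** Here [f] is bounded and [h] integrable, so the inner integral runs over [y]. This case serves to
    the left of [theta], where the integrable derivative of [u] takes the place of [h]. *)
Lemma integrable_frac_kernel_right a b r f h M : a < b -> 0 < r ->
  measurable_fun `]a, b[ f -> mu.-integrable `]a, b[ (EFin \o h) ->
  (forall x, a < x < b -> `|f x| <= M) ->
  (mu \x mu)%E.-integrable setT
    (fun z : R * R => (frac_kernel a b r f h z.1 z.2)%:E).
Proof.
move=> ab r0 mf inth fM.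
have mh : measurable_fun `]a, b[ h.
  by apply/measurable_EFinP; case/integrableP: inth.
have M0 : 0 <= M.
  by apply: le_trans (normr_ge0 _) (fM ((a + b) / 2) _); lra.
have mK := measurable_frac_kernel r mf mh.
have mH : measurable_fun setT (h \_ `]a, b[) by apply/(measurable_restrictT _ _).1.
have ba0 : 0 < b - a by rewrite subr_gt0.
apply: (@integrable12ltyP _ _ _ _ R mu mu _ mK).2.
set C := (M * ((b - a) `^ r / r)).
have C0 : 0 <= C by rewrite mulr_ge0// divr_ge0 ?powR_ge0// ltW.
apply: (@le_lt_trans _ _ (\int[mu]_x (C%:E * `|((h \_ `]a, b[) x)%:E|)%E)%E).
  apply: ge0_le_integral => //.
  - by move=> x _; exact: integral_ge0.
  - apply: (@measurable_fun_fubini_tonelli_F _ _ _ _ R mu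
      (fun z : R * R => `|(frac_kernel a b r f h z.1 z.2)%:E|)%E) => //.
    exact: measurableT_comp mK.
  - by apply: emeasurable_funM => //; apply: measurableT_comp => //; exact/measurable_EFinP.
  move=> x _.
  have -> : (C%:E * `|((h \_ `]a, b[) x)%:E|)%E =
      (\int[mu]_y (`|(h \_ `]a, b[) x| * M * powk_upto r (b - a) y)%:E)%E.
    by rewrite integral_powk_upto ?mulr_ge0// -EFinM /C; congr EFin; ring.
  rewrite (@ge0_integral_affine _ (-1) x)//; last 2 first.
  - by apply/measurable_EFinP; apply: measurable_funM => //; exact: measurable_betaI.
  - by move=> y; rewrite lee_fin mulr_ge0 ?powk_upto_ge0// mulr_ge0.
  rewrite normrN1 mul1e; apply: ge0_le_integral => //.
  - by apply: measurableT_comp => //; exact: (measurableT_comp mK (measurable_pair1 _)).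
  - apply/measurable_EFinP; apply: measurable_funM => //.
    apply: (measurableT_comp (measurable_betaI r 1 (b - a))).
    exact: measurable_affine.
  move=> y _; rewrite /= lee_fin (_ : -1 * y + x = x - y); last by ring.
  apply: le_trans (frac_kernel_le _ _ _ _ _ _ _) _.
  rewrite ler_wpM2r ?powk_upto_ge0// mulrC ler_wpM2l// patchE mem_setE in_itv/=.
  by case: ifPn => [/fM//|_]; rewrite normr0.
rewrite ge0_integralZl//; last by apply: measurableT_comp => //; exact/measurable_EFinP.
rewrite lte_mul_pinfty// ?lee_fin//; exact: restrict_norm_lty.
Qed.

End fractional_fubini.

(** * Riemann-Stieltjes integrals and integration by parts *)

Section riemann_stieltjes.
Context {R : realType}.
Local Notation mu := (@lebesgue_measure R).
Implicit Types (a b : R) (phi g h F : R -> R).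

Lemma RS_sumB a b phi h1 h2 s t :
  RS_sum a b phi (h1 \- h2) s t = RS_sum a b phi h1 s t - RS_sum a b phi h2 s t.
Proof. by rewrite /RS_sum -sumrB; apply: eq_bigr => i _ /=; ring. Qed.

Lemma is_RS_integralB a b phi h1 h2 I1 I2 :
  is_RS_integral a b phi h1 I1 -> is_RS_integral a b phi h2 I2 ->
  is_RS_integral a b phi (h1 \- h2) (I1 - I2).
Proof.
move=> H1 H2 e e0; have e20 : 0 < e / 2 by rewrite divr_gt0.
have [d1 d10 P1] := H1 _ e20; have [d2 d20 P2] := H2 _ e20.
exists (Num.min d1 d2); first by rewrite lt_min d10.
move=> s t abs st; rewrite RS_sumB.
have {}P1 := P1 s t abs; have {}P2 := P2 s t abs.
have : `|RS_sum a b phi h1 s t - I1| < e / 2.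
  apply: P1 => i /st[? []]; rewrite lt_min => ? /andP[? _].
  by split.
have : `|RS_sum a b phi h2 s t - I2| < e / 2.
  apply: P2 => i /st[? []]; rewrite lt_min => ? /andP[_ ?].
  by split.
rewrite !ltr_norml => /andP[? ?] /andP[? ?].
by apply/andP; split; lra.
Qed.

Lemma itv_partition_nth_itv a b s i : itv_partition a b s -> (i <= size s)%N ->
  nth b (a :: s) i \in `[a, b].
Proof.
by move=> abs si; rewrite in_itv/= itv_partition_nth_ge//= itv_partition_nth_le.
Qed.

Lemma is_RS_integral_eq a b phi h1 h2 I : {in `[a, b], h1 =1 h2} ->
  is_RS_integral a b phi h1 I -> is_RS_integral a b phi h2 I.
Proof.
move=> h12 H e /H[d d0 P]; exists d => // s t abs st.
suff -> : RS_sum a b phi h2 s t = RS_sum a b phi h1 s t by exact: P.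
apply: eq_bigr => i _; rewrite !h12//.
- by apply: (itv_partition_nth_itv abs); exact: ltnW.
- exact: (itv_partition_nth_itv abs).
Qed.

Lemma uniform_itv_partition a b (d : R) : a <= b -> 0 < d ->
  exists2 s, itv_partition a b s &
    forall i, (i < size s)%N -> nth b (a :: s) i.+1 - nth b (a :: s) i < d.
Proof.
rewrite le_eqVlt => /predU1P[<- d0|ab d0]; first by exists [::].
set m := (Num.truncn ((b - a) / d)).+1.
have m0 : (0 < m%:R :> R) by rewrite ltr0n.
exists (mkseq (fun i => cell a b m i.+1) m); rewrite ?size_mkseq.
  split; last by rewrite (last_nth 0) size_mkseq [nth _ _ _]nth_mkseq// cell_last.
  apply/(pathP 0) => i; rewrite size_mkseq => im.
  have -> : nth 0 (a :: mkseq (fun i => cell a b m i.+1) m) i = cell a b m i.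
    case: i im => [|i] im /=; first by rewrite cell0.
    by rewrite nth_mkseq// ltnW.
  rewrite nth_mkseq// ltrD2l ltr_pM2r ?ltr_nat//.
  by rewrite divr_gt0// subr_gt0.
move=> i im.
have -> : nth b (a :: mkseq (fun i => cell a b m i.+1) m) i = cell a b m i.
  case: i im => [|i] im /=; first by rewrite cell0.
  by rewrite nth_mkseq// ltnW.
rewrite /= nth_mkseq// /cell -natr1 opprD addrACA subrr add0r -mulrBl addrAC.
rewrite subrr add0r mul1r ltr_pdivrMr// mulrC -ltr_pdivrMr//.
exact: truncnS_gt.
Qed.

(** A uniform subdivision fine enough for both limits has a sum close to both. Uniqueness is what
    identifies the value chosen by [get] in [RS_integral]. *)
Lemma is_RS_integral_unique a b phi h I1 I2 : a <= b ->
  is_RS_integral a b phi h I1 -> is_RS_integral a b phi h I2 -> I1 = I2.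
Proof.
move=> ab H1 H2; apply/eqP; rewrite -subr_eq0 -normr_le0; apply/ler_addgt0Pr => e e0.
rewrite add0r; have e20 : 0 < e / 2 by rewrite divr_gt0.
have [d1 d10 P1] := H1 _ e20; have [d2 d20 P2] := H2 _ e20.
have d0 : 0 < Num.min d1 d2 by rewrite lt_min d10.
have [s abs sd] := uniform_itv_partition ab d0.
pose t i := nth b (a :: s) i.
have tag d' : Num.min d1 d2 <= d' -> forall i, (i < size s)%N ->
    nth b (a :: s) i <= t i /\ t i <= nth b (a :: s) i.+1 /\
    nth b (a :: s) i.+1 - nth b (a :: s) i < d'.
  move=> dd i si; split; [by []|split].
    exact: (itv_partition_nth_homo abs (leqnSn i) si).
  exact: lt_le_trans (sd i si) dd.
have h1 : `|RS_sum a b phi h s t - I1| < e / 2.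
  by apply: P1 => //; apply: tag; rewrite ge_min lexx.
have h2 : `|RS_sum a b phi h s t - I2| < e / 2.
  by apply: P2 => //; apply: tag; rewrite ge_min lexx orbT.
move: h1 h2; rewrite !ltr_norml ler_norml => /andP[h1 h2] /andP[h3 h4].
by apply/andP; split; lra.
Qed.

Lemma RS_integralE a b phi h I : a <= b ->
  is_RS_integral a b phi h I -> RS_integral a b phi h = I.
Proof.
move=> ab HI; apply: (is_RS_integral_unique ab _ HI).
exact: (getPex (ex_intro [set I | is_RS_integral a b phi h I] I HI)).
Qed.

Lemma integrable_bounded a b g (M : R) : measurable_fun `[a, b] g ->
  (forall x, a <= x <= b -> `|g x| <= M) -> mu.-integrable `[a, b] (EFin \o g).
Proof.
move=> mg gM; apply: measurable_bounded_integrable => //.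
  by rewrite /= lebesgue_measure_itv/=; case: ifP; rewrite ?ltry// -EFinD ltry.
exists M; split; first exact: num_real.
by move=> M' MM' x /=; rewrite in_itv/= => /gM /le_trans; apply; exact: ltW.
Qed.

Lemma monotone_measurable a b h : a <= b ->
  {in `[a, b] &, {homo h : x y / x <= y}} -> measurable_fun `[a, b] h.
Proof.
move=> ab ndh; pose cl (x : R) := Num.max a (Num.min x b).
have clab x : cl x \in `[a, b].
  by rewrite in_itv/= /cl le_max lexx ge_max ab ge_min lexx orbT.
have ndcl x y : x <= y -> cl x <= cl y.
  by move=> xy; rewrite /cl ge_max le_max lexx/= le_max; apply/orP; right;
    rewrite le_min ge_min xy ge_min lexx orbT.
apply: (@eq_measurable_fun _ _ _ _ _ (h \o cl)).
  move=> x; rewrite inE/= in_itv/= => /andP[ax xb].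
  by rewrite /cl (min_idPl xb) (max_idPr ax).
apply: nondecreasing_measurable => // x y xy /=.
by apply: ndh => //; exact: ndcl.
Qed.

Lemma monotone_inner_bounds a b F : a < b -> {in `[a, b] &, {homo F : x y / x <= y}} ->
  [/\ cvg (F y @[y --> a^'+]), cvg (F y @[y --> b^'-]) &
    forall y, a < y < b -> lim (F y @[y --> a^'+]) <= F y <= lim (F y @[y --> b^'-])].
Proof.
move=> ab ndF.
have ca : cvg (F y @[y --> a^'+]).
  apply: nondecreasing_at_right_is_cvgr.
  - near=> s => x y /=; rewrite !in_itv/= => /andP[ax xs] /andP[ay ys] xy.
    have sb : s <= b by near: s; exact: nbhs_right_le.
    by apply: ndF => //; rewrite in_itv/= ?(ltW ax) ?(ltW ay)/= (le_trans _ sb)// ltW.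
  - near=> s; exists (F a) => _ /= [y + <-]; rewrite in_itv/= => /andP[ay ys].
    have sb : s <= b by near: s; exact: nbhs_right_le.
    by apply: ndF; rewrite ?in_itv/= ?lexx ?(ltW ab) ?(ltW ay)//= (le_trans _ sb)// ltW.
have cb : cvg (F y @[y --> b^'-]).
  apply: nondecreasing_at_left_is_cvgr.
  - near=> s => x y /=; rewrite !in_itv/= => /andP[sx xb] /andP[sy yb] xy.
    have sa : a <= s by near: s; exact: nbhs_left_ge.
    by apply: ndF => //; rewrite in_itv/= ?(ltW xb) ?(ltW yb) ?andbT (le_trans sa)// ltW.
  - near=> s; exists (F b) => _ /= [y + <-]; rewrite in_itv/= => /andP[sy yb].
    have sa : a <= s by near: s; exact: nbhs_left_ge.
    by apply: ndF; rewrite ?in_itv/= ?lexx ?(ltW ab) ?(ltW yb) ?andbT//= (le_trans sa)// ltW.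
split=> // y /andP[ay yb]; apply/andP; split.
- apply: (limr_le ca); near=> z.
  have az : a < z by near: z; exact: nbhs_right_gt.
  have zy : z <= y by near: z; exact: nbhs_right_le.
  by apply: ndF; rewrite ?in_itv/= ?(ltW ay) ?(ltW yb) ?(ltW az) ?(le_trans zy (ltW yb)).
- apply: (limr_ge cb); near=> z.
  have zb : z < b by near: z; exact: nbhs_left_lt.
  have yz : y <= z by near: z; exact: nbhs_left_ge.
  by apply: ndF; rewrite ?in_itv/= ?(ltW ay) ?(ltW yb) ?(ltW zb) ?andbT ?(le_trans (ltW ay) yz).
Unshelve. all: by end_near. Qed.

(** Monotonicity survives the change of the end values, so the formula for monotone integrators
    applies directly to [inner_ends]. The midpoint compares the two one-sided limits with each
    other. *)
Lemma inner_ends_monotone a b F : a < b -> {in `[a, b] &, {homo F : x y / x <= y}} ->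
  {in `[a, b] &, {homo inner_ends a b F : x y / x <= y}}.
Proof.
move=> ab ndF; have [_ _ H] := monotone_inner_bounds ab ndF.
have /andP[m1 m2] : lim (F y @[y --> a^'+]) <= F ((a + b) / 2) <= lim (F y @[y --> b^'-]).
  by apply: H; apply/andP; split; lra.
move=> x y xab yab xy.
have := ndF x y xab yab xy.
move: xab yab; rewrite !in_itv/= /inner_ends => /andP[ax xb] /andP[ay yb] Fxy.
have [xa|xa] := eqVneq x a; have [ya|ya] := eqVneq y a => //.
- have [yb'|yb'] := eqVneq y b; first exact: le_trans m1 m2.
  have /H/andP[]// : a < y < b by rewrite !lt_neqAle ay yb yb' eq_sym ya.
- by move: xa; rewrite eq_le ax -ya xy.
- have [xb'|xb'] := eqVneq x b.
    by have -> : y == b by rewrite eq_le yb -xb' xy.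
  have Hx : a < x < b by rewrite !lt_neqAle ax xb xb' eq_sym xa.
  have [yb'|yb'] := eqVneq y b => //.
  by have /andP[] := H _ Hx.
Qed.

Section parts.
Context (a b : R) (phi g : R -> R) (M : R) (ab : a <= b).
Context (mg : measurable_fun `[a, b] g) (gM : forall x, a <= x <= b -> `|g x| <= M).
Context (phiE : forall x, a <= x <= b -> phi x = phi a + \int[mu]_(t in `]a, x]) g t).

Let M0 : 0 <= M.
Proof. by apply: le_trans (normr_ge0 _) (gM (x := a) _); rewrite lexx ab. Qed.

Section monotone.
Context (h : R -> R) (ndh : {in `[a, b] &, {homo h : x y / x <= y}}).

Let ig : mu.-integrable `[a, b] (EFin \o g).
Proof. exact: integrable_bounded gM. Qed.

Lemma integrable_monotoneM : mu.-integrable `[a, b] (EFin \o (fun t => h t * g t)).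
Proof.
apply: (@integrable_bounded _ _ _ ((`|h a| + `|h b|) * M)).
  by apply: measurable_funM => //; exact: monotone_measurable.
move=> x axb; rewrite normrM ler_pM// ?gM//.
have /andP[ax xb] := axb.
have h1 : h a <= h x by apply: ndh; rewrite ?in_itv/= ?lexx ?ab.
have h2 : h x <= h b by apply: ndh; rewrite ?in_itv/= ?lexx ?ab.
rewrite ler_norml; have := ler_norm (h b); have := ler_norm (- h a).
have := normr_ge0 (h a); have := normr_ge0 (h b).
by rewrite normrN => ? ? ? ?; apply/andP; split; lra.
Qed.

Let ihg := integrable_monotoneM.

Let sub x y : a <= x -> y <= b -> `]x, y]%classic `<=` `[a, b].
Proof.
move=> ax yb z /=; rewrite !in_itv/= => /andP[xz zy].
by rewrite (le_trans ax (ltW xz)) (le_trans zy yb).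
Qed.

Let Psi x := \int[mu]_(t in `]a, x]) (h t * g t).

(** The left side is the integral of [(h - c) * g] over []p, q]], whose integrand is at most [D * M]
    in absolute value. *)
Let oscillation p q (c D : R) : a <= p -> p <= q -> q <= b -> 0 <= D ->
  (forall y, p <= y <= q -> `|h y - c| <= D) ->
  `|(Psi q - Psi p) - c * (phi q - phi p)| <= D * M * (q - p).
Proof.
move=> ap pq qb D0 hc.
have aq := le_trans ap pq; have pb := le_trans pq qb.
have iT (f : R -> R) x y : mu.-integrable `[a, b] (EFin \o f) -> a <= x -> y <= b ->
    mu.-integrable `]x, y] (EFin \o f).
  by move=> intf ax yb; apply: integrableS intf => //; exact: sub.
have E1 : Psi q - Psi p = \int[mu]_(t in `]p, q]) (h t * g t).
  by rewrite /Psi Rintegral_itvB ?bnd_simp//; exact: iT.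
have E2 : phi q - phi p = \int[mu]_(t in `]p, q]) g t.
  rewrite (phiE (x := q)) ?aq// (phiE (x := p)) ?ap// opprD addrACA subrr add0r.
  by rewrite Rintegral_itvB ?bnd_simp//; exact: iT.
have ihc : mu.-integrable `]p, q] (EFin \o (fun t => c * g t)).
  rewrite (_ : _ \o _ = fun t => c%:E * (EFin \o g) t)%E//.
  by apply: integrableZl => //; exact: iT.
have ihg' : mu.-integrable `]p, q] (EFin \o (fun t => h t * g t)) by exact: iT.
rewrite E1 E2 -RintegralZl//; last exact: iT.
rewrite -RintegralB//.
have id : mu.-integrable `]p, q] (EFin \o (fun t => h t * g t - c * g t)).
  rewrite (_ : _ \o _ = (EFin \o (fun t => h t * g t)%R) \-
      (EFin \o (fun t => c * g t)%R))%E//.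
  exact: integrableB.
have mI : measurable (`]p, q]%classic : set (measurableTypeR R)) by exact: measurable_itv.
apply: le_trans (le_normr_Rintegral mI id) _.
have -> : D * M * (q - p) = \int[mu]_(t in `]p, q]) (D * M).
  by rewrite Rintegral_cst//= lebesgue_measure_itv/= lte_fin;
    case: ltP => [//|qp]; rewrite (_ : q = p) ?subrr//; apply/le_anti/andP.
apply: le_Rintegral => //.
- exact: integrable_norm id.
- apply: measurable_bounded_integrable => //.
    by rewrite /= lebesgue_measure_itv/=; case: ifP; rewrite ?ltry// -EFinD ltry.
  by exists (D * M); split; [exact: num_real|move=> M' MM' x _; rewrite ger0_norm ?mulr_ge0// ltW].
move=> t; rewrite /= in_itv/= => /andP[pt tq].
rewrite -mulrBl normrM ler_pM// ?hc ?gM// ?(ltW pt)//.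
by rewrite (le_trans ap (ltW pt)) (le_trans tq qb).
Qed.

(* The error of a Riemann-Stieltjes sum is the sum over the cells
   [[x_i, x_i.+1]] with tag [t_i] of the integrals of [(h - h x_i.+1) * g] on
   [[t_i, x_i.+1]] and of [(h - h x_i) * g] on [[x_i, t_i]]. *)
Lemma is_RS_integral_parts_monotone : is_RS_integral a b phi h
    (h b * phi b - h a * phi a - \int[mu]_(t in `]a, b]) (h t * g t)).
Proof.
have hab : h a <= h b by apply: ndh; rewrite ?in_itv/= ?lexx ?ab.
(* With mesh below [e / K] the errors of the cells telescope to at most [(h b - h a) * M * (e / K)];
   the added 1 makes [K] positive and the final inequality strict. *)
pose K := (h b - h a) * M + 1.
have K0 : 0 < K by rewrite ltr_wpDl// mulr_ge0// subr_ge0.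
move=> e e0; exists (e / K); first by rewrite divr_gt0.
move=> s t abs st; set x := nth b (a :: s).
have xab i : (i <= size s)%N -> a <= x i <= b.
  by move=> /(itv_partition_nth_itv abs); rewrite in_itv.
have tel (F : R -> R) : F b - F a = \sum_(i < size s) (F (x i.+1) - F (x i)).
  rewrite -(big_mkord xpredT (fun i => F (x i.+1) - F (x i))).
  rewrite (telescope_sumr (F \o x))//=.
  by rewrite /x (itv_partition_nth_size b abs).
have Psia : Psi a = 0 by rewrite /Psi set_itvoc0 Rintegral_set0.
rewrite -/(Psi b) -[Psi b]subr0 -Psia (tel Psi) (tel (fun y => h y * phi y)).
rewrite -sumrB -sumrB.
apply: (@le_lt_trans _ _ (\sum_(i < size s) (h (x i.+1) - h (x i)) * M * (e / K))).
  apply: le_trans (ler_norm_sum _ _ _) _; apply: ler_sum => i _.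
  have [xt [tx xd]] := st i (ltn_ord i).
  rewrite -/x in xt tx xd.
  have /andP[ax xb] := xab _ (ltnW (ltn_ord i)).
  have /andP[ax' xb'] := xab _ (ltn_ord i).
  have xx' : x i <= x i.+1 := le_trans xt tx.
  have D0 : 0 <= h (x i.+1) - h (x i).
    by rewrite subr_ge0; apply: ndh; rewrite ?in_itv/= ?ax ?ax'.
  have hx y : x i <= y <= x i.+1 -> h (x i) <= h y <= h (x i.+1).
    move=> /andP[xy yx]; have ay := le_trans ax xy; have yb := le_trans yx xb'.
    by apply/andP; split; apply: ndh; rewrite ?in_itv/= ?ax ?ax' ?ay.
  have o1 := @oscillation (t i) (x i.+1) (h (x i.+1)) _ (le_trans ax xt) tx xb' D0.
  have o2 := @oscillation (x i) (t i) (h (x i)) _ ax xt (le_trans tx xb') D0.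
  have {}o1 : `|(Psi (x i.+1) - Psi (t i)) - h (x i.+1) * (phi (x i.+1) - phi (t i))| <=
      (h (x i.+1) - h (x i)) * M * (x i.+1 - t i).
    apply: o1 => y /andP[ty yx]; have /hx/andP[h1 h2] : x i <= y <= x i.+1.
      by rewrite (le_trans xt ty).
    by rewrite ler_norml; apply/andP; split; lra.
  have {}o2 : `|(Psi (t i) - Psi (x i)) - h (x i) * (phi (t i) - phi (x i))| <=
      (h (x i.+1) - h (x i)) * M * (t i - x i).
    apply: o2 => y /andP[xy yt]; have /hx/andP[h1 h2] : x i <= y <= x i.+1.
      by rewrite xy (le_trans yt tx).
    by rewrite ler_norml; apply/andP; split; lra.
  apply: (@le_trans _ _ ((h (x i.+1) - h (x i)) * M * (x i.+1 - x i))); last first.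
    by rewrite ler_wpM2l ?mulr_ge0// ltW.
  have -> : x i.+1 - x i = (x i.+1 - t i) + (t i - x i) by ring.
  rewrite [leRHS]mulrDr; apply: (le_trans _ (lerD o1 o2)).
  apply: (le_trans _ (ler_normD _ _)); rewrite le_eqVlt; apply/orP; left; apply/eqP.
  by congr Num.norm; ring.
rewrite -mulr_suml -mulr_suml -(tel h) mulrCA gtr_pMr// ltr_pdivrMr// mul1r.
by rewrite /K ltrDl.
Qed.

End monotone.

(** Split [h] into a difference of nondecreasing functions. Their one-sided limits exist, so
    [inner_ends] commutes with the difference; inside the interval it changes nothing, and the
    endpoints are null for the Lebesgue integral. *)
Lemma RS_integral_oo_parts h : a < b -> bounded_variation a b h ->
  RS_integral_oo a b phi h = lim (h y @[y --> b^'-]) * phi b -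
    lim (h y @[y --> a^'+]) * phi a - \int[mu]_(t in `]a, b[) (h t * g t).
Proof.
move=> ab' bv; set P := fine \o pos_tv a h; set N := fine \o neg_tv a h.
have ndP : {in `[a, b] &, {homo P : x y / x <= y}}.
  exact: fine_neg_tv_nondecreasing (bounded_variationN bv).
have ndN : {in `[a, b] &, {homo N : x y / x <= y}} by exact: fine_neg_tv_nondecreasing.
have hPN : {in `[a, b], h =1 P \- N} by exact: bounded_variation_pos_neg_tvE.
have [cPa cPb _] := monotone_inner_bounds ab' ndP.
have [cNa cNb _] := monotone_inner_bounds ab' ndN.
have la : lim (h y @[y --> a^'+]) =
    lim (P y @[y --> a^'+]) - lim (N y @[y --> a^'+]).
  apply: cvg_lim => //; apply: cvg_trans (cvgB cPa cNa).
  apply: near_eq_cvg; near=> y; rewrite hPN// in_itv/=; apply/andP; split.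
    by near: y; exact: nbhs_right_ge.
  by near: y; exact: nbhs_right_le.
have lb : lim (h y @[y --> b^'-]) =
    lim (P y @[y --> b^'-]) - lim (N y @[y --> b^'-]).
  apply: cvg_lim => //; apply: cvg_trans (cvgB cPb cNb).
  apply: near_eq_cvg; near=> y; rewrite hPN// in_itv/=; apply/andP; split.
    by near: y; exact: nbhs_left_ge.
  by near: y; exact: nbhs_left_le.
have iPN : {in `[a, b], inner_ends a b P \- inner_ends a b N =1 inner_ends a b h}.
  move=> x xab; rewrite /= /inner_ends la lb.
  by case: ifP => // _; case: ifP => // _; rewrite hPN.
have ndiP := inner_ends_monotone ab' ndP.
have ndiN := inner_ends_monotone ab' ndN.
apply: RS_integralE => //.
have := is_RS_integralB (is_RS_integral_parts_monotone ndiP) (is_RS_integral_parts_monotone ndiN).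
move=> /(is_RS_integral_eq iPN); congr is_RS_integral.
have ioc F : {in `[a, b] &, {homo F : x y / x <= y}} ->
    mu.-integrable `]a, b] (EFin \o (fun t => F t * g t)).
  move=> ndF; apply: integrableS (integrable_monotoneM ndF) => //.
  by move=> x /=; rewrite !in_itv/= => /andP[/ltW -> ->].
have inbb : inner_ends a b h b = lim (h y @[y --> b^'-]).
  by rewrite /inner_ends gt_eqF// eqxx.
have inaa : inner_ends a b h a = lim (h y @[y --> a^'+]).
  by rewrite /inner_ends eqxx.
rewrite -inbb -inaa -!iPN ?in_itv/= ?lexx ?ab//.
have -> : \int[mu]_(t in `]a, b[) (h t * g t) =
    \int[mu]_(t in `]a, b]) (inner_ends a b P t * g t) -
    \int[mu]_(t in `]a, b]) (inner_ends a b N t * g t).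
  have iB : mu.-integrable `]a, b] (EFin \o (fun t =>
      inner_ends a b P t * g t - inner_ends a b N t * g t)).
    rewrite (_ : _ \o _ = (EFin \o (fun t => inner_ends a b P t * g t)%R) \-
      (EFin \o (fun t => inner_ends a b N t * g t)%R))%E//.
    by apply: integrableB => //; exact: ioc.
  rewrite -RintegralB//; [|exact: ioc|exact: ioc].
  transitivity (\int[mu]_(t in `]a, b[)
     (inner_ends a b P t * g t - inner_ends a b N t * g t)).
    apply: eq_Rintegral => t; rewrite inE/= in_itv/= => /andP[at_ tb].
    have := iPN t; rewrite /= in_itv/= (ltW at_) (ltW tb) => /(_ isT).
    rewrite -mulrBl => ->; rewrite /inner_ends gt_eqF// lt_eqF//.
  apply: Rintegral_itv_bndo_bndc.
  apply: integrableS iB => // x /=; rewrite !in_itv/= => /andP[-> /ltW ->].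
  by [].
rewrite /=; ring.
Unshelve. all: by end_near. Qed.

End parts.
End riemann_stieltjes.

(** * Rising factorials and the reflection of Jacobi polynomials *)

Section pochhammer_theory.
Context {R : realType}.
Implicit Types (c b al : R).

Lemma pochhammer0 c : pochhammer c 0 = 1.
Proof. by rewrite /pochhammer big_ord0. Qed.

Lemma pochhammerD c i j :
  pochhammer c (i + j) = pochhammer c i * pochhammer (c + i%:R) j.
Proof.
rewrite /pochhammer big_split_ord/=; congr (_ * _).
by apply: eq_bigr => l _ /=; rewrite natrD addrA.
Qed.

Lemma pochhammerS c j : pochhammer c j.+1 = pochhammer c j * (c + j%:R).
Proof. by rewrite /pochhammer big_ord_recr. Qed.

Lemma pochhammerSl c j : pochhammer c j.+1 = c * pochhammer (c + 1) j.
Proof.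
by rewrite -add1n pochhammerD /pochhammer big_ord1 addr0.
Qed.

Lemma pochhammer_gt0 c j : 0 < c -> 0 < pochhammer c j.
Proof. by move=> c0; apply: prodr_gt0 => i _; rewrite ltr_wpDr. Qed.

Lemma pochhammer_fact n j : n`!%:R * pochhammer (n%:R + 1) j = (n + j)`!%:R :> R.
Proof.
elim: j => [|j ih]; first by rewrite pochhammer0 mulr1 addn0.
rewrite pochhammerS mulrA ih addnS factS natrM mulrC; congr (_ * _).
by rewrite -natr1 natrD; ring.
Qed.

Lemma pochhammer_opp c N : pochhammer (- c) N = (-1) ^+ N * pochhammer (c - N%:R + 1) N.
Proof.
rewrite /pochhammer (reindex_inj rev_ord_inj)/=.
rewrite -[X in (-1) ^+ X](card_ord N) -prodrN; apply: eq_bigr => i _.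
by rewrite natrB ?(ltn_ord i)// -natr1; ring.
Qed.

Lemma Gamma_pochhammer c j : 0 < c -> Gamma (c + j%:R) = pochhammer c j * Gamma c.
Proof.
move=> c0; elim: j => [|j ih]; first by rewrite addr0 pochhammer0 mul1r.
rewrite -natr1 addrA GammaS ?ih ?pochhammerS; first by ring.
by rewrite ltr_wpDr.
Qed.

Lemma Gamma_nat n : Gamma (n%:R + 1) = n`!%:R :> R.
Proof.
rewrite addrC Gamma_pochhammer// Gamma1 mulr1.
by have := pochhammer_fact 0 n; rewrite fact0 mul1r add0r add0n.
Qed.

(** Induction on [N]. Pascal's rule splits each binomial coefficient; after a shift of index the two
    terms carrying ['C(N, i)] combine through [(c + i%:R) - (b + i%:R) = c - b], the factor by which
    the right side grows. *)
Lemma Chu_Vandermonde N b c :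
  \sum_(m < N.+1) 'C(N, m)%:R * (-1) ^+ m * pochhammer b m * pochhammer (c + m%:R) (N - m)
  = pochhammer (c - b) N.
Proof.
elim: N b c => [|N ih] b c.
  by rewrite big_ord_recl big_ord0 /= !pochhammer0 bin0; ring.
rewrite pochhammerSl.
have -> : c - b + 1 = c + 1 - b by ring.
rewrite -ih mulr_sumr.
rewrite big_ord_recl/=.
under eq_bigr => i _ do rewrite /bump/= add1n binS natrD !mulrDl.
rewrite big_split/= addrA.
have -> : 'C(N.+1, 0)%:R * (-1) ^+ 0 * pochhammer b 0 * pochhammer (c + 0%:R) (N.+1 - 0) +
   \sum_(i < N.+1) 'C(N, i.+1)%:R * (-1) ^+ i.+1 * pochhammer b i.+1 *
       pochhammer (c + i.+1%:R) (N.+1 - i.+1) =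
   \sum_(i < N.+1) 'C(N, i)%:R * (-1) ^+ i * pochhammer b i *
       pochhammer (c + i%:R) (N.+1 - i).
  rewrite big_ord_recr/= (@bin_small N N.+1)// !mul0r addr0 [RHS]big_ord_recl/= !bin0.
  by rewrite !addr0; congr (_ + _); apply: eq_bigr => i _; rewrite /bump/= add1n.
rewrite -big_split/=; apply: eq_bigr => i _.
have iN : (i <= N)%N by rewrite -ltnS.
rewrite subSn// pochhammerSl subSS pochhammerS exprS.
have -> : c + i%:R + 1 = c + 1 + i%:R by ring.
have -> : c + i.+1%:R = c + 1 + i%:R by rewrite -natr1; ring.
by ring.
Qed.

Lemma jacobi_opp_param al be n x : al + be = 0 ->
  jacobi al be n x = \sum_(j < n.+1)
    pochhammer (n%:R + 1) j * pochhammer (al + j%:R + 1) (n - j)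
    / (j`! * (n - j)`!)%:R * ((x - 1) / 2) ^+ j.
Proof.
move=> ab; rewrite /jacobi; apply: eq_bigr => j _.
by rewrite (_ : n%:R + al + be + 1 = n%:R + 1)//; rewrite -[n%:R + al + be]addrA ab addr0.
Qed.

(** With [y = (x - 1) / 2] the argument of the reflected polynomial is [- (1 + y)]. Expanding its
    powers in [y] and exchanging the sums makes each coefficient a Chu-Vandermonde sum. *)
Lemma jacobi_reflection al be n x : al + be = 0 ->
  jacobi be al n x = (-1) ^+ n * jacobi al be n (- x).
Proof.
move=> ab; have -> : be = - al by apply/eqP; rewrite -addr_eq0 addrC ab.
rewrite !jacobi_opp_param ?subrr ?addNr//.
pose y : R := (x - 1) / 2.
have -> : (- x - 1) / 2 = - (1 + y) by rewrite /y; field.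
rewrite -/y mulr_sumr.
pose A (j : nat) : R := pochhammer (n%:R + 1) j * pochhammer (al + j%:R + 1) (n - j)
  / (j`! * (n - j)`!)%:R.
have expand (j : 'I_n.+1) : (-1) ^+ n * (A j * (- (1 + y)) ^+ j) =
    \sum_(i < n.+1) (-1) ^+ (n + j) * A j * 'C(j, i)%:R * y ^+ i.
  have -> : (- (1 + y)) ^+ j = (-1) ^+ j * \sum_(i < n.+1) 'C(j, i)%:R * y ^+ i.
    rewrite [LHS]exprNn; congr (_ * _); rewrite exprDn.
    rewrite (big_ord_widen n.+1 (fun i => 1 ^+ (j - i) * y ^+ i *+ 'C(j, i)))//.
    rewrite big_mkcond/=; apply: eq_bigr => i _.
    rewrite expr1n mul1r -[_ *+ _]mulr_natl; case: ltnP => // ij.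
    by rewrite bin_small// mul0r.
  by rewrite !mulr_sumr; apply: eq_bigr => i _; rewrite exprD; ring.
rewrite (eq_bigr _ (fun j _ => expand j)) exchange_big/=; apply: eq_bigr => i _.
rewrite -mulr_suml; congr (_ * _).
have iN : (i <= n)%N by rewrite -ltnS.
rewrite -(big_mkord xpredT (fun j => (-1) ^+ (n + j) * A j * 'C(j, i)%:R)).
rewrite (big_cat_nat (n := i))//=; last exact: leqW.
rewrite big1_seq ?add0r; last first.
  by move=> j; rewrite mem_index_iota => /andP[_ /andP[_ ji]]; rewrite bin_small// mulr0.
have shift (F : nat -> R) :
    \sum_(i <= j < n.+1) F j = \sum_(m < (n - i).+1) F (m + i)%N.
  by rewrite -{1}[nat_of_ord i]add0n big_addn big_mkord subSn.
rewrite shift.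
set N := (n - i)%N.
have nE : n%:R = i%:R + N%:R :> R by rewrite -natrD subnKC.
have f0 k : k`!%:R != 0 :> R by rewrite pnatr_eq0 -lt0n fact_gt0.
(* The common value of both coefficients: its last factor has argument [al - n]. On one side it
   comes from reversing the factors of the rising factorial at [- al + i + 1], on the other from
   Chu-Vandermonde with [b = n + 1 + i] and [c = al + i + 1]. *)
transitivity ((-1) ^+ N * (pochhammer (n%:R + 1) i / (i`!%:R * N`!%:R)) *
    pochhammer (al + i%:R + 1 - (n%:R + 1 + i%:R)) N).
  rewrite natrM.
  have -> : - al + i%:R + 1 = - (al - i%:R - 1) by ring.
  rewrite pochhammer_opp.
  have -> : al - i%:R - 1 - N%:R + 1 = al + i%:R + 1 - (n%:R + 1 + i%:R).
    by rewrite nE; ring.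
  by field; rewrite !f0.
rewrite -Chu_Vandermonde mulr_sumr; apply: eq_bigr => m _.
have mN : (m <= N)%N by rewrite -ltnS.
rewrite /A (_ : (n - (m + i) = N - m)%N); last by rewrite addnC subnDA.
rewrite addnC [(m + i)%N]addnC pochhammerD natrD addrA.
have -> : al + i%:R + m%:R + 1 = al + i%:R + 1 + m%:R by ring.
have := bin_fact (leq_addr m i); rewrite addKn => /(congr1 (fun k => k%:R : R)).
rewrite !natrM => bE.
have := bin_fact mN => /(congr1 (fun k => k%:R : R)); rewrite !natrM => bE'.
have sgn : (-1) ^+ (i + m + n) = (-1) ^+ N * (-1) ^+ m :> R.
  rewrite (_ : (i + m + n = 2 * i + (N + m))%N); last by rewrite /N; lia.
  by rewrite exprD exprM sqrrN expr1n expr1n mul1r exprD.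
have b0 : 'C(i + m, i)%:R != 0 :> R by rewrite pnatr_eq0 -lt0n bin_gt0 leq_addr.
have b0' : 'C(N, m)%:R != 0 :> R by rewrite pnatr_eq0 -lt0n bin_gt0.
by rewrite -bE -bE' sgn; field; rewrite !f0 b0 b0'.
Qed.

End pochhammer_theory.

(** * Legendre polynomials and their primitives in powers of [1 - x] *)

Section legendre_primitives.
Context {R : realType}.

(* The [k]-fold primitive of the Legendre polynomial vanishing to order [k] at
   both endpoints, for [k <= n]. *)
Definition legendre_prim (n k : nat) : {poly R} :=
  (2 ^+ n * n`!%:R)^-1 *: (('X ^+ 2 - 1) ^+ n)^`(n - k).

Lemma legendre_prim0 n : legendre_prim n 0 = legendre n.
Proof. by rewrite /legendre_prim subn0. Qed.

Lemma derivn_XsubC_exp (c : R) m i :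
  (('X - c%:P) ^+ m)^`(i) = ('X - c%:P) ^+ (m - i) *+ m ^_ i.
Proof.
elim: i => [|i ih]; first by rewrite derivn0 subn0 ffactn0 mulr1n.
rewrite derivnS ih derivMn deriv_exp derivXsubC mul1r -mulrnA.
by rewrite ffactnSr subnS mulnC.
Qed.

(** The coefficient of [(1 - x) ^+ j] in [P_n], namely [(-1) ^+ j * 'C(n, j) * 'C(n + j, j) / 2 ^+
    j]. *)
Definition legendre_coef1 (n j : nat) : R :=
  (-1) ^+ j * 'C(n, j)%:R * (n + j)`!%:R / (n`!%:R * j`!%:R * 2 ^+ j).

(** Expand [(X - 1) ^+ n * (2 + (X - 1)) ^+ n] about 1 and differentiate [n - k] times. The sign
    [(-1) ^+ k] appears because right-sided integration from 1 inverts minus the derivative. *)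
Lemma legendre_primE n k (x : R) : (k <= n)%N ->
  (-1) ^+ k * (legendre_prim n k).[x] =
  \sum_(j < n.+1) legendre_coef1 n j * (j`!%:R / (j + k)`!%:R) * (1 - x) ^+ (j + k).
Proof.
move=> kn.
have f0 m : m`!%:R != 0 :> R by rewrite pnatr_eq0 -lt0n fact_gt0.
rewrite /legendre_prim.
have -> : ('X ^+ 2 - 1) ^+ n = \sum_(j < n.+1)
    ('C(n, j)%:R * 2 ^+ (n - j)) *: ('X - 1%:P) ^+ (n + j) :> {poly R}.
  rewrite -[in LHS](expr1n _ 2) subr_sqr exprMn.
  have -> : 'X + 1 = 2%:P + ('X - 1%:P) :> {poly R}.
    by rewrite (natrD _ 1 1) polyCD polyC1; ring.
  rewrite [(2%:P + _) ^+ n]exprDn mulr_sumr; apply: eq_bigr => j _.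
  rewrite -mul_polyC polyCM polyC_exp polyC_natr exprD -[(_ * _) *+ _]mulr_natl.
  by rewrite polyC1; ring.
rewrite (raddf_sum (derivn (n - k)))/= hornerZ horner_sum !mulr_sumr.
apply: eq_bigr => j _; have jn : (j <= n)%N by rewrite -ltnS.
rewrite derivnZ derivn_XsubC_exp hornerZ hornerMn horner_exp hornerXsubC.
have -> : (n + j - (n - k) = j + k)%N by lia.
have -> : (x - 1) ^+ (j + k) = (-1) ^+ (j + k) * (1 - x) ^+ (j + k).
  by rewrite -exprMn mulN1r opprB.
rewrite -[(_ * _) *+ _]mulr_natl /legendre_coef1.
have := ffact_fact (leq_trans (leq_subr k n) (leq_addr j n)).
have -> : (n + j - (n - k) = j + k)%N by lia.
move=> /(congr1 (fun m => m%:R : R)); rewrite natrM => <-.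
have -> : 2 ^+ n = 2 ^+ j * 2 ^+ (n - j) :> R by rewrite -exprD subnKC.
rewrite exprD; have s2 : (-1) ^+ k * (-1) ^+ k = 1 :> R by rewrite -expr2 sqrr_sign.
have p2 m : 2 ^+ m != 0 :> R by rewrite expf_neq0.
by rewrite -[RHS]mul1r -[X in _ = X * _]s2; field; rewrite !f0 !p2.
Qed.

Lemma legendre_prim_powsum n k (x : R) : (k <= n)%N -> x <= 1 ->
  (-1) ^+ k * (legendre_prim n k).[x] = powsum (legendre_coef1 n) n.+1 k%:R x.
Proof.
move=> kn x1; rewrite legendre_primE//; apply: eq_bigr => j _.
rewrite (_ : j%:R + 1 + k%:R = (j + k)%:R + 1); last by rewrite natrD; ring.
by rewrite Gamma_nat -natrD powR_mulrn ?subr_ge0.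
Qed.

Lemma legendre_prim_at1 n k : (0 < k <= n)%N -> (legendre_prim n k).[1 : R] = 0.
Proof.
move=> /andP[k0 kn]; apply: (mulfI (negbT (signr_eq0 R k))).
rewrite mulr0 legendre_primE//; apply: big1 => j _.
by rewrite subrr expr0n addn_eq0 (gtn_eqF k0) andbF mulr0.
Qed.

(** The polynomial [('X ^+ 2 - 1) ^+ n] is even and each derivative changes the parity. This
    transfers the vanishing at 1, visible in the expansion, to -1. *)
Lemma legendre_prim_opp n k (x : R) : (k <= n)%N ->
  (legendre_prim n k).[- x] = (-1) ^+ (n - k) * (legendre_prim n k).[x].
Proof.
have comp (p : {poly R}) m : (p \Po (- 'X))^`(m) = (-1) ^+ m *: (p^`(m) \Po (- 'X)).
  elim: m => [|m ih]; first by rewrite expr0 scale1r.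
  rewrite derivnS ih derivZ deriv_comp -derivnS derivN derivX.
  by rewrite mulrN1 scalerN exprS mulN1r scaleNr.
have even (y : R) m : ((('X ^+ 2 - 1) ^+ n)^`(m)).[- y] =
    (-1) ^+ m * ((('X ^+ 2 - 1) ^+ n)^`(m)).[y].
  have := comp (('X ^+ 2 - 1) ^+ n) m.
  rewrite rmorphXn rmorphB rmorphXn rmorph1/= comp_polyX sqrrN.
  move=> /(congr1 (horner^~ y)); rewrite hornerZ horner_comp hornerN hornerX => ->.
  by rewrite mulrA -expr2 sqrr_sign mul1r.
by move=> _; rewrite /legendre_prim !hornerZ even mulrCA.
Qed.

Lemma legendre_prim_atN1 n k : (0 < k <= n)%N -> (legendre_prim n k).[-1 : R] = 0.
Proof.
by move=> kn; rewrite legendre_prim_opp ?legendre_prim_at1 ?mulr0//; case/andP: kn.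
Qed.

Lemma powsum_jacobi n al (x : R) : 0 < al -> x <= 1 ->
  powsum (legendre_coef1 n) n.+1 al x =
  (1 - x) `^ al / Gamma (al + 1) * (jacobi al (- al) n x / jacobi al (- al) n 1).
Proof.
move=> al0; rewrite le_eqVlt => /predU1P[->|x1].
  rewrite subrr powR0 ?gt_eqF// !mul0r /powsum big1// => j _.
  by rewrite subrr powR0 ?mulr0// gt_eqF// ltr_wpDl.
have f0 m : m`!%:R != 0 :> R by rewrite pnatr_eq0 -lt0n fact_gt0.
have a10 : 0 < al + 1 by rewrite addr_gt0.
have -> : jacobi al (- al) n 1 = pochhammer (al + 1) n / n`!%:R.
  rewrite jacobi_opp_param ?subrr// big_ord_recl big1 => [|j _]; last first.
    by rewrite mul0r expr0n mulr0.
  by rewrite pochhammer0 mul1r expr0 mulr1 addr0 subn0 mul1n addr0.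
rewrite jacobi_opp_param ?subrr// /powsum mulr_suml mulr_sumr.
apply: eq_bigr => j _; have jn : (j <= n)%N by rewrite -ltnS.
have aj0 : 0 < al + j%:R by rewrite ltr_wpDr.
have -> : j%:R + 1 + al = al + 1 + j%:R by ring.
rewrite Gamma_pochhammer// [j%:R + al]addrC powRD ?gt_eqF ?subr_gt0 ?implybT//.
rewrite powR_mulrn ?subr_ge0 ?(ltW x1)//.
have -> : pochhammer (al + 1) n = pochhammer (al + 1) j * pochhammer (al + j%:R + 1) (n - j).
  rewrite -[in LHS](subnKC jn) pochhammerD; congr (_ * pochhammer _ _); ring.
have G0 : Gamma (al + 1) != 0 by rewrite gt_eqF// Gamma_gt0.
have p0 : pochhammer (al + 1) j != 0 by rewrite gt_eqF// pochhammer_gt0.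
have p1 : pochhammer (al + j%:R + 1) (n - j) != 0.
  by rewrite gt_eqF// pochhammer_gt0// ltr_wpDl// addr_ge0// ltW.
have t2 : 2 ^+ j != 0 :> R by rewrite expf_neq0.
have -> : (x - 1) / 2 = (-1) * (1 - x) / 2 by ring.
rewrite expr_div_n exprMn /legendre_coef1 -pochhammer_fact natrM.
have := bin_fact jn => /(congr1 (fun m => m%:R : R)); rewrite !natrM => bE.
have b0 : 'C(n, j)%:R != 0 :> R by rewrite pnatr_eq0 -lt0n bin_gt0.
by rewrite -bE; field; rewrite !f0 b0 p0 p1 t2 G0.
Qed.

End legendre_primitives.

(** * Fractional integration by parts and bounds on power sums *)

Section fractional_parts.
Context {R : realType}.
Local Notation mu := (@lebesgue_measure R).
Implicit Types (a b r s t x y : R) (f g h u : R -> R).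

Lemma ae_impl (P Q : R -> Prop) : (forall x, P x -> Q x) ->
  {ae mu, forall x, P x} -> {ae mu, forall x, Q x}.
Proof. by move=> PQ; apply: filterS; first exact: (ae_filter_ringOfSetsType mu). Qed.

Lemma ae_impl2 (P P' Q : R -> Prop) : (forall x, P x -> P' x -> Q x) ->
  {ae mu, forall x, P x} -> {ae mu, forall x, P' x} -> {ae mu, forall x, Q x}.
Proof. by move=> PQ; apply: filterS2; first exact: (ae_filter_ringOfSetsType mu). Qed.

Lemma Rintegral_ae_nonmeasurable (D : set R) f g :
  f = g %[ae mu in D] -> \int[mu]_(x in D) f x = \int[mu]_(x in D) g x.
Proof.
move=> fg; rewrite /Rintegral; congr fine; apply: integral_ae_nonmeasurable.
by apply: ae_impl fg => x fgx /fgx ->.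
Qed.

Lemma ae_neq a : {ae mu, forall x, x != a}.
Proof.
exists [set a]; split => //; first exact: lebesgue_measure_set1.
by move=> x /= /negP/negPn/eqP.
Qed.

Lemma Rintegral_itv_oo a b (ba bb : bool) f :
  \int[mu]_(x in [set` Interval (BSide ba a) (BSide bb b)]) f x =
  \int[mu]_(x in `]a, b[) f x.
Proof.
rewrite Rintegral_mkcond [RHS]Rintegral_mkcond; apply: Rintegral_ae_nonmeasurable.
apply: ae_impl2 (ae_neq a) (ae_neq b) => x xa xb _.
rewrite !patchE !mem_setE !in_itv/=.
have -> : (a < x ?<= if ba) = (a < x) by case: ba => //=; rewrite lt_neqAle eq_sym xa.
by have -> : (x < b ?<= if ~~ bb) = (x < b) by case: bb => //=; rewrite lt_neqAle xb.
Qed.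

Lemma ae_subset (A B : set R) f g : A `<=` B -> f = g %[ae mu in B] ->
  f = g %[ae mu in A].
Proof. by move=> AB; apply: ae_impl => x fgx /AB. Qed.

(** For nonzero [r] the integrals agree at every point of the interval; the identity at order 0
    accounts for the almost everywhere conclusion. *)
Lemma frac_int_left_ae a b r f g : f = g %[ae mu in `]a, b[%classic] ->
  frac_int_left a r f = frac_int_left a r g %[ae mu in `]a, b[%classic].
Proof.
move=> fg; rewrite /frac_int_left; case: eqP => // _; have := fg; apply: ae_impl => x _ /=.
rewrite in_itv/= => /andP[ax xb]; congr (_ * _); apply: Rintegral_ae_nonmeasurable.
apply: ae_impl fg => y fgy; rewrite /= in_itv/= => /andP[ay yx].
by rewrite fgy//= in_itv/= ay (lt_trans yx).
Qed.

Lemma frac_int_right_ae a b r f g : f = g %[ae mu in `]a, b[%classic] ->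
  frac_int_right b r f = frac_int_right b r g %[ae mu in `]a, b[%classic].
Proof.
move=> fg; rewrite /frac_int_right; case: eqP => // _; have := fg; apply: ae_impl => x _ /=.
rewrite in_itv/= => /andP[ax xb]; congr (_ * _); apply: Rintegral_ae_nonmeasurable.
apply: ae_impl fg => y fgy; rewrite /= in_itv/= => /andP[xy yb].
by rewrite fgy//= in_itv/= yb (lt_trans ax).
Qed.

Lemma eq_frac_int_left a r f g x : r != 0 ->
  (forall y, a < y < x -> f y = g y) -> frac_int_left a r f x = frac_int_left a r g x.
Proof.
move=> r0 fg; rewrite /frac_int_left (negbTE r0); congr (_ * _).
by apply: eq_Rintegral => y; rewrite inE/= in_itv/= => /fg ->.
Qed.

Lemma eq_frac_int_right b r f g x : r != 0 ->
  (forall y, x < y < b -> f y = g y) -> frac_int_right b r f x = frac_int_right b r g x.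
Proof.
move=> r0 fg; rewrite /frac_int_right (negbTE r0); congr (_ * _).
by apply: eq_Rintegral => y; rewrite inE/= in_itv/= => /fg ->.
Qed.

Lemma frac_int_left1 a f x : frac_int_left a 1 f x = \int[mu]_(y in `]a, x[) f y.
Proof.
rewrite /frac_int_left oner_eq0 Gamma1 invr1 mul1r; apply: eq_Rintegral => y _.
by rewrite subrr powRr0 divr1.
Qed.

Lemma frac_int_right1 b f x : frac_int_right b 1 f x = \int[mu]_(y in `]x, b[) f y.
Proof.
rewrite /frac_int_right oner_eq0 Gamma1 invr1 mul1r; apply: eq_Rintegral => y _.
by rewrite subrr powRr0 divr1.
Qed.

(** Order 0, which occurs when [mu] equals [k], is included: both fractional integrals are then the
    identity. *)
Lemma frac_parts_left a b r f h (M : R) : a < b -> 0 <= r ->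
  mu.-integrable `]a, b[ (EFin \o f) -> measurable_fun `]a, b[ h ->
  (forall x, a < x < b -> `|h x| <= M) ->
  \int[mu]_(x in `]a, b[) (frac_int_left a r f x * h x) =
  \int[mu]_(y in `]a, b[) (f y * frac_int_right b r h y).
Proof.
move=> ab; rewrite le_eqVlt => /predU1P[<- *|r0 intf mh hM].
  by apply: eq_Rintegral => x _; rewrite /frac_int_left /frac_int_right eqxx.
exact: (frac_fubini r0 (integrable_frac_kernel_left ab r0 intf mh hM)).
Qed.

Lemma frac_parts_right a b r f h (M : R) : a < b -> 0 <= r ->
  measurable_fun `]a, b[ f -> mu.-integrable `]a, b[ (EFin \o h) ->
  (forall x, a < x < b -> `|f x| <= M) ->
  \int[mu]_(x in `]a, b[) (frac_int_left a r f x * h x) =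
  \int[mu]_(y in `]a, b[) (f y * frac_int_right b r h y).
Proof.
move=> ab; rewrite le_eqVlt => /predU1P[<- *|r0 mf inth fM].
  by apply: eq_Rintegral => x _; rewrite /frac_int_left /frac_int_right eqxx.
exact: (frac_fubini r0 (integrable_frac_kernel_right ab r0 mf inth fM)).
Qed.

Lemma integrable_boundedM a b f h (M : R) : mu.-integrable `]a, b[ (EFin \o f) ->
  measurable_fun `]a, b[ h -> (forall x, a < x < b -> `|h x| <= M) ->
  mu.-integrable `]a, b[ (EFin \o (fun x => f x * h x)).
Proof.
move=> intf mh hM.
rewrite (_ : _ \o _ = (EFin \o f) \* (EFin \o h))%E//.
apply: integrableMl => //; exists M; split; first exact: num_real.
by move=> M' MM' x /=; rewrite in_itv/= => /hM/le_trans; apply; exact: ltW.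
Qed.

Lemma measurable_powsum c N r : measurable_fun setT (powsum c N r : R -> R).
Proof.
apply: measurable_sum => j; apply: measurable_funM => //.
by apply: (measurableT_comp (measurable_powR _)); exact: measurable_funB.
Qed.

Lemma powsum_bounded (c : nat -> R) N r : 0 <= r ->
  exists M, forall x, -1 <= x <= 1 -> `|powsum c N r x| <= M.
Proof.
move=> r0; exists (\sum_(j < N) `|c j * (j`!%:R / Gamma (j%:R + 1 + r))| * 2 `^ (j%:R + r)).
move=> x /andP[x1 x2]; apply: le_trans (ler_norm_sum _ _ _) _.
apply: ler_sum => j _; rewrite normrM ler_wpM2l// ger0_norm ?powR_ge0//.
have j0 : 0 <= j%:R :> R by [].
by apply: ge0_ler_powR; rewrite ?nnegrE; lra.
Qed.

Lemma powsumZ (k : R) c N r x : k * powsum c N r x = powsum (fun j => k * c j) N r x.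
Proof. by rewrite /powsum mulr_sumr; apply: eq_bigr => j _; rewrite !mulrA. Qed.

Lemma powsum_at1 (c : nat -> R) N r : 0 < r -> powsum c N r 1 = 0.
Proof.
move=> r0; rewrite /powsum big1// => j _; rewrite subrr powR0 ?mulr0// gt_eqF//.
by rewrite ltr_wpDl.
Qed.

Lemma frac_int_left_powsum_opp (c : nat -> R) N s r x : 0 <= s -> 0 <= r -> -1 <= x ->
  frac_int_left (-1) r (fun y => powsum c N s (- y)) x = powsum c N (s + r) (- x).
Proof.
move=> s0; rewrite le_eqVlt => /predU1P[<- _|r0 x1].
  by rewrite /frac_int_left eqxx addr0.
rewrite frac_int_left_opp; last first.
  by apply: measurable_funTS; exact: measurableT_comp (measurable_powsum c N s) _.
rewrite opprK; transitivity (frac_int_right 1 r (powsum c N s) (- x)); last first.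
  by apply: frac_int_right_powsum; rewrite // lerNl.
by apply: eq_frac_int_right; rewrite ?gt_eqF// => y _ /=; rewrite opprK.
Qed.

Lemma frac_int_right_powsum0 (c : nat -> R) N s r x : 0 <= s -> 0 <= r -> x <= 1 ->
  frac_int_right 1 r (powsum c N s) x = powsum c N (s + r) x.
Proof.
move=> s0; rewrite le_eqVlt => /predU1P[<- _|r0 x1]; last exact: frac_int_right_powsum.
by rewrite /frac_int_right eqxx addr0.
Qed.

Lemma bounded_variation_measurable_bounded a b f : a <= b -> bounded_variation a b f ->
  measurable_fun `[a, b] f /\ exists M, forall x, a <= x <= b -> `|f x| <= M.
Proof.
move=> ab bv; set P := fine \o pos_tv a f; set N := fine \o neg_tv a f.
have ndP : {in `[a, b] &, {homo P : x y / x <= y}}.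
  exact: fine_neg_tv_nondecreasing (bounded_variationN bv).
have ndN : {in `[a, b] &, {homo N : x y / x <= y}} by exact: fine_neg_tv_nondecreasing.
have fPN : {in `[a, b], f =1 P \- N} by exact: bounded_variation_pos_neg_tvE.
split.
  apply: (@eq_measurable_fun _ _ _ _ _ (P \- N)).
    by move=> x; rewrite inE/= => /fPN ->.
  by apply: measurable_funB; exact: monotone_measurable.
exists (`|P a| + `|P b| + (`|N a| + `|N b|)) => x axb.
have xab : x \in `[a, b] by rewrite in_itv.
have aab : a \in `[a, b] by rewrite in_itv/= lexx.
have bab : b \in `[a, b] by rewrite in_itv/= lexx ab.
move: axb => /andP[ax xb].
have := ndP a x aab xab ax; have := ndP x b xab bab xb.
have := ndN a x aab xab ax; have := ndN x b xab bab xb.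
rewrite fPN//= ler_norml.
have := ler_norm (P b); have := ler_norm (- P a).
have := ler_norm (N b); have := ler_norm (- N a).
have := normr_ge0 (P a); have := normr_ge0 (P b).
have := normr_ge0 (N a); have := normr_ge0 (N b).
by rewrite !normrN => ? ? ? ? ? ? ? ? ? ? ? ?; apply/andP; split; lra.
Qed.

End fractional_parts.

(** * Integration by parts on the whole interval and on each side of [theta] *)

Section caputo_parts.
Context {R : realType}.
Local Notation mu := (@lebesgue_measure R).
Implicit Types (c : nat -> R) (r s t x y : R) (f g h u v w phi : R -> R).

Lemma integrable_powsum c N s a b : -1 <= a -> b <= 1 -> 0 <= s ->
  mu.-integrable `]a, b[ (EFin \o powsum c N s).
Proof.
move=> a1 b1 s0; have [M HM] := powsum_bounded c N s0.
have mp : measurable_fun `[(-1 : R), 1] (powsum c N s).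
  by apply: measurable_funTS; exact: measurable_powsum.
apply: integrableS (integrable_bounded mp HM) => // x /=.
rewrite !in_itv/= => /andP[ax xb].
by rewrite (le_trans a1 (ltW ax)) (le_trans (ltW xb)).
Qed.

(** On the open interval [f - f (-1)] is the integral of order 1 of the derivative, and the Fubini
    exchange moves it onto the power sum, raising its order to [s + 1]. The constant contributes
    [f (-1)] times the value of the raised sum at -1, which is 0. *)
Lemma abs_cont_parts c N s f : 0 <= s -> powsum c N (s + 1) (-1) = 0 ->
  abs_cont (-1) 1 f ->
  \int[mu]_(x in `]-1, 1[) (f x * powsum c N s x) =
  \int[mu]_(x in `]-1, 1[) (derive_on `[-1, 1] f x * powsum c N (s + 1) x).
Proof.
move=> s0 pN1 acf; have N11 : -1 < 1 :> R by lra.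
have [g ig [fE dg]] := abs_cont_FTC N11 acf.
have [M HM] := powsum_bounded c N s0.
have HM' x : -1 < x < 1 -> `|powsum c N s x| <= M.
  by move=> /andP[x1 x2]; apply: HM; rewrite !ltW.
have mp : measurable_fun `](-1 : R), 1[ (powsum c N s).
  by apply: measurable_funTS; exact: measurable_powsum.
have [mf [M' HM'']] := bounded_variation_measurable_bounded (ltW N11)
  (abs_cont_bounded_variation acf).
have fI x : -1 < x < 1 -> frac_int_left (-1) 1 g x = f x - f (-1).
  move=> /andP[x1 x2]; rewrite (fE x) ?(ltW x1) ?(ltW x2)// frac_int_left1.
  by rewrite [in RHS]Rintegral_itv_oo addrAC subrr add0r.
have if_ : mu.-integrable `]-1, 1[ (EFin \o f).
  apply: integrableS (integrable_bounded mf HM'') => //.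
  exact: subset_itv_oo_cc.
have ifp : mu.-integrable `]-1, 1[ (EFin \o (fun x => f x * powsum c N s x)).
  exact: integrable_boundedM if_ mp HM'.
have ip : mu.-integrable `]-1, 1[ (EFin \o powsum c N s) by exact: integrable_powsum.
have icp : mu.-integrable `]-1, 1[ (EFin \o (fun x => f (-1) * powsum c N s x)).
  rewrite (_ : _ \o _ = fun x => (f (-1))%:E * (EFin \o powsum c N s) x)%E//.
  exact: integrableZl.
have ig' : mu.-integrable `]-1, 1[ (EFin \o g) by exact: integrableS ig.
have p0 : \int[mu]_(x in `]-1, 1[) (f (-1) * powsum c N s x) = 0.
  by rewrite RintegralZl// -frac_int_right1 frac_int_right_powsum// ?pN1 ?mulr0//; lra.
transitivity (\int[mu]_(x in `]-1, 1[) (frac_int_left (-1) 1 g x * powsum c N s x)).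
  rewrite -[LHS]subr0 -p0 -RintegralB//; apply: eq_Rintegral => x.
  by rewrite inE/= in_itv/= => /fI ->; rewrite mulrBl.
rewrite (frac_parts_left N11 ler01 ig' mp HM').
apply: Rintegral_ae_nonmeasurable; apply: ae_impl dg => x + xin.
have := xin; rewrite /= !in_itv/= => /andP[x1 x2] ->; last by rewrite !ltW.
by rewrite frac_int_right_powsum// ltW.
Qed.

Lemma caputo_left_parts c N theta s r g v phi : -1 <= theta -> theta < 1 ->
  0 <= s -> 0 <= r ->
  mu.-integrable `]theta, 1[ (EFin \o g) -> bounded_variation theta 1 v ->
  frac_int_left theta r g = v %[ae mu in `]theta, 1[%classic] ->
  (forall x, theta <= x <= 1 -> phi x = powsum c N (s + 1) x) ->
  \int[mu]_(x in `]theta, 1[) (g x * powsum c N (s + r) x) =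
  phi theta * lim (v x @[x --> theta^'+]) + RS_integral_oo theta 1 phi v.
Proof.
move=> t1 t2 s0 r0 ig bv gv phiE; have [M HM] := powsum_bounded c N s0.
have HM' x : theta <= x <= 1 -> `|powsum c N s x| <= M.
  by move=> /andP[x1 x2]; apply: HM; rewrite x2 (le_trans t1).
have HMo x : theta < x < 1 -> `|powsum c N s x| <= M.
  by move=> /andP[x1 x2]; apply: HM'; rewrite !ltW.
have mp (D : set R) : measurable D -> measurable_fun D (powsum c N s).
  by move=> mD; apply: measurable_funTS; exact: measurable_powsum.
have [mv [M' Hv]] := bounded_variation_measurable_bounded (ltW t2) bv.
have s10 : 0 < s + 1 by lra.
have iv : mu.-integrable `]theta, 1[ (EFin \o v).
  apply: integrableS (integrable_bounded mv Hv) => //.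
  exact: subset_itv_oo_cc.
have ivp : mu.-integrable `]theta, 1[ (EFin \o (fun x => v x * powsum c N s x)).
  by apply: integrable_boundedM iv _ HMo; exact: mp.
transitivity (\int[mu]_(x in `]theta, 1[) (v x * powsum c N s x)).
  transitivity (\int[mu]_(y in `]theta, 1[) (g y * frac_int_right 1 r (powsum c N s) y)).
    apply: eq_Rintegral => y; rewrite inE/= in_itv/= => /andP[_ y1].
    by rewrite frac_int_right_powsum0// ltW.
  rewrite -(frac_parts_left t2 r0 ig _ HMo); last exact: mp.
  apply: Rintegral_ae_nonmeasurable; apply: ae_impl gv => x gvx xin.
  by rewrite gvx.
(* The limit of [v] at 1 enters the parts formula only multiplied by this value. *)
have phi1 : phi 1 = 0 by rewrite phiE ?powsum_at1// lexx ltW.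
have parts : forall x, theta <= x <= 1 ->
    phi x = phi theta + \int[mu]_(t in `]theta, x]) (- powsum c N s t).
  move=> x /andP[tx x1].
  have ioo y z : -1 <= y -> z <= 1 -> mu.-integrable `]y, z] (EFin \o powsum c N s).
    move=> y1 z1; have mp1 := mp `[(-1 : R), 1]%classic (measurable_itv _).
    apply: integrableS (integrable_bounded mp1 HM) => // t /=.
    rewrite !in_itv/= => /andP[yt tz].
    by rewrite (le_trans y1 (ltW yt)) (le_trans tz).
  rewrite (_ : \int[mu]_(t in _) _ = - \int[mu]_(t in `]theta, x]) powsum c N s t); last first.
    rewrite -[RHS]mulN1r -RintegralZl//; last by apply: ioo.
    by apply: eq_Rintegral => t _; rewrite mulN1r.
  have prim y : theta <= y <= 1 -> phi y = \int[mu]_(t in `]y, 1]) powsum c N s t.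
    move=> /andP[ty y1]; rewrite phiE ?ty// -frac_int_right_powsum// frac_int_right1.
    by rewrite [RHS]Rintegral_itv_oo.
  rewrite !prim ?lexx ?tx ?(ltW t2)//.
  by rewrite -(Rintegral_itvB (ioo _ _ t1 (lexx 1)) (x := x)) ?bnd_simp.
rewrite (@RS_integral_oo_parts _ theta 1 phi (fun t => - powsum c N s t) M)//; first last.
- by move=> x /HM'; rewrite normrN.
- by apply: measurableT_comp => //; exact: mp.
- exact: ltW.
have -> : \int[mu]_(t in `]theta, 1[) (v t * - powsum c N s t) =
    - \int[mu]_(t in `]theta, 1[) (v t * powsum c N s t).
  rewrite -[RHS]mulN1r -RintegralZl//.
  by apply: eq_Rintegral => t _; rewrite mulN1r mulrN.
by rewrite phi1; ring.
Qed.

(** Here [e] is the sign [(-1) ^+ k] of the right-sided Caputo derivative, and the powers are those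
    of [1 + x]. As [phi] is a primitive of [psi] itself, vanishing at -1, whereas on the other side
    it is a primitive of the opposite, the Stieltjes integral changes sign. *)
Lemma caputo_right_parts c N theta s r (e : R) g w phi : -1 < theta -> theta <= 1 ->
  0 <= s -> 0 <= r -> e * e = 1 ->
  mu.-integrable `]-1, theta[ (EFin \o g) -> bounded_variation (-1) theta w ->
  (fun x => e * frac_int_right theta r g x) = w %[ae mu in `]-1, theta[%classic] ->
  (forall x, -1 <= x <= theta -> phi x = powsum c N (s + 1) (- x)) ->
  e * \int[mu]_(x in `]-1, theta[) (g x * powsum c N (s + r) (- x)) =
  phi theta * lim (w x @[x --> theta^'-]) - RS_integral_oo (-1) theta phi w.
Proof.
move=> t1 t2 s0 r0 ee ig bw gw phiE; have [M HM] := powsum_bounded c N s0.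
pose psi y := powsum c N s (- y).
have HM' x : -1 <= x <= theta -> `|psi x| <= M.
  by move=> /andP[x1 x2]; apply: HM; rewrite lerNl opprK lerNl x1 (le_trans x2).
have HMo x : -1 < x < theta -> `|psi x| <= M.
  by move=> /andP[x1 x2]; apply: HM'; rewrite !ltW.
have mp (D : set R) : measurable D -> measurable_fun D psi.
  move=> mD; apply: measurable_funTS.
  exact: measurableT_comp (measurable_powsum c N s) _.
have [mw [M' Hw]] := bounded_variation_measurable_bounded (ltW t1) bw.
have iw : mu.-integrable `]-1, theta[ (EFin \o w).
  apply: integrableS (integrable_bounded mw Hw) => //.
  exact: subset_itv_oo_cc.
have iwp : mu.-integrable `]-1, theta[ (EFin \o (fun x => w x * psi x)).
  by apply: integrable_boundedM iw _ HMo; exact: mp.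
have -> : e * \int[mu]_(x in `]-1, theta[) (g x * powsum c N (s + r) (- x)) =
    \int[mu]_(x in `]-1, theta[) (w x * psi x).
  rewrite -[RHS]mul1r -[X in _ = X * _]ee -mulrA; congr (_ * _); rewrite -RintegralZl//.
  transitivity (\int[mu]_(x in `]-1, theta[) (frac_int_left (-1) r psi x * g x)).
    apply: eq_Rintegral => y; rewrite inE/= in_itv/= => /andP[y1 _].
    by rewrite mulrC frac_int_left_powsum_opp// ltW.
  rewrite (frac_parts_right t1 r0 _ ig HMo); last exact: mp.
  apply: Rintegral_ae_nonmeasurable; apply: ae_impl gw => x gwx xin.
  by rewrite -gwx// !mulrA ee mul1r mulrC.
have phi1 : phi (-1) = 0 by rewrite phiE ?opprK ?powsum_at1 ?lexx ?(ltW t1)//; lra.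
have parts : forall x, -1 <= x <= theta ->
    phi x = phi (-1) + \int[mu]_(t in `]-1, x]) psi t.
  move=> x /andP[tx x1]; rewrite phi1 add0r Rintegral_itv_oo -frac_int_left1.
  by rewrite frac_int_left_powsum_opp// phiE// tx.
rewrite (@RS_integral_oo_parts _ (-1) theta phi psi M)//; first last.
- exact: mp.
- exact: ltW.
by rewrite phi1; ring.
Qed.

End caputo_parts.

(** * Fractional integrals of Legendre polynomials from both ends *)

Section legendre_fractional.
Context {R : realType}.
Local Notation mu := (@lebesgue_measure R).
Implicit Types (r s x y : R) (u : R -> R) (n k : nat).

Lemma legendre_powsum n x : x <= 1 ->
  (legendre n).[x] = powsum (legendre_coef1 n) n.+1 0 x.
Proof.
move=> x1; have := legendre_prim_powsum (leq0n n) x1.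
by rewrite expr0 mul1r legendre_prim0.
Qed.

Lemma legendre_powsum_opp n x : -1 <= x ->
  (legendre n).[x] = powsum (fun j => (-1) ^+ n * legendre_coef1 n j) n.+1 0 (- x).
Proof.
move=> x1; rewrite -powsumZ -legendre_powsum; last by rewrite lerNl.
by rewrite -legendre_prim0 legendre_prim_opp// subn0 mulrA -expr2 sqrr_sign mul1r.
Qed.

(** The [k]-th primitives from 1 and from -1 agree up to sign because both are multiples of
    [legendre_prim n k]. The sign is absorbed by the one in the right-sided Caputo derivative. *)
Lemma powsum_legendre_opp n k x : (k <= n)%N -> -1 <= x <= 1 ->
  powsum (legendre_coef1 n) n.+1 k%:R x =
  (-1) ^+ k * powsum (fun j => (-1) ^+ n * legendre_coef1 n j) n.+1 k%:R (- x).
Proof.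
move=> kn /andP[x1 x2]; rewrite -powsumZ -!legendre_prim_powsum//; last by rewrite lerNl.
have -> : (-1) ^+ n = (-1) ^+ (n - k) * (-1) ^+ k :> R by rewrite -exprD subnK.
rewrite legendre_prim_opp//.
have s1 : (-1) ^+ k * (-1) ^+ k = 1 :> R by rewrite -expr2 sqrr_sign.
have s2 : (-1) ^+ (n - k) * (-1) ^+ (n - k) = 1 :> R by rewrite -expr2 sqrr_sign.
set a := (-1) ^+ k in s1 *; set b := (-1) ^+ (n - k) in s2 *.
rewrite [RHS](_ : _ = (a * a) * (b * b) * (a * (legendre_prim n k).[x])); last by ring.
by rewrite s1 s2 !mul1r.
Qed.

Lemma powsum_legendre_atN1 n k : (0 < k <= n)%N ->
  powsum (legendre_coef1 n) n.+1 k%:R (-1 : R) = 0.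
Proof.
move=> kn; have [_ kn'] := andP kn.
by rewrite -legendre_prim_powsum ?legendre_prim_atN1 ?mulr0//; lra.
Qed.

Lemma frac_int_right_legendre n r x : 0 < r -> x <= 1 ->
  frac_int_right 1 r (fun y => (legendre n).[y]) x =
  powsum (legendre_coef1 n) n.+1 r x.
Proof.
move=> r0 x1; rewrite -[r in RHS]add0r -frac_int_right_powsum//.
apply: eq_frac_int_right; first by rewrite gt_eqF.
by move=> y /andP[_ y1]; rewrite legendre_powsum// ltW.
Qed.

Lemma frac_int_left_legendre n r x : 0 < r -> -1 <= x ->
  frac_int_left (-1) r (fun y => (legendre n).[y]) x =
  powsum (fun j => (-1) ^+ n * legendre_coef1 n j) n.+1 r (- x).
Proof.
move=> r0 x1; rewrite -[r in RHS]add0r -frac_int_left_powsum_opp ?(ltW r0)//.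
apply: eq_frac_int_left; first by rewrite gt_eqF.
by move=> y /andP[y1 _]; rewrite legendre_powsum_opp// ltW.
Qed.

(** Each of the [k] steps uses that the next primitive, of order [j.+1] with [j.+1 <= k <= n],
    vanishes at -1. *)
Lemma legendre_coef_parts n k u : (k <= n)%N -> abs_cont_derivs (-1) 1 k u ->
  \int[mu]_(x in `[-1, 1]) (u x * (legendre n).[x]) =
  \int[mu]_(x in `]-1, 1[) (derive_on_n `[-1, 1] k u x *
    powsum (legendre_coef1 n) n.+1 k%:R x).
Proof.
move=> kn hu; rewrite Rintegral_itv_oo.
have : (k <= k)%N by [].
elim: {1 3 4}k => [_|j ih jk].
  apply: eq_Rintegral => x; rewrite inE/= in_itv/= => /andP[_ /ltW x1].
  by rewrite legendre_powsum.
rewrite ih; last exact: ltnW.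
have [_ acj] := hu j jk.
have pN1 : powsum (legendre_coef1 n) n.+1 (j%:R + 1) (-1) = 0 :> R.
  by rewrite natr1 powsum_legendre_atN1//= (leq_trans jk).
by have := abs_cont_parts (ler0n _ j) pN1 acj; rewrite natr1.
Qed.

End legendre_fractional.

(** * The formula for the Legendre coefficients *)

Unset Implicit Arguments.
Set Strict Implicit.
Set Printing Implicit Defensive.

(* v and w are the BV functions with which the Caputo derivatives of u are
   identified on [theta, 1] and [-1, theta]. *)
Theorem theorem1 (R : realType) (k : nat) (mu theta : R) (u v w : R -> R)
    (hk : (1 <= k)%N)
    (hmu : k%:R - 1 < mu /\ mu <= k%:R)
    (htheta : -1 < theta /\ theta < 1)
    (hu : abs_cont_derivs (-1) 1 k u)
    (hv : bounded_variation theta 1 v)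
    (huv : caputo_left `[-1, 1] theta k mu u = v
             %[ae lebesgue_measure in `[theta, 1]%classic])
    (hw : bounded_variation (-1) theta w)
    (huw : caputo_right `[-1, 1] theta k mu u = w
             %[ae lebesgue_measure in `[-1, theta]%classic])
    (n : nat) (hn : mu + 1 <= n%:R) :
  let Ir := frac_int_right 1 (mu + 1) (fun x => (legendre n).[x]) in
  let Il := frac_int_left (-1) (mu + 1) (fun x => (legendre n).[x]) in
  legendre_coef u n =
    (2 * n%:R + 1) / 2 *
      (Ir theta * lim (v x @[x --> theta^'+])
       + RS_integral_oo theta 1 Ir v
       + Il theta * lim (w x @[x --> theta^'-])
       - RS_integral_oo (-1) theta Il w)
  /\ (forall x : R, -1 <= x <= 1 ->
        Ir x = (1 - x) `^ (mu + 1) / Gamma (mu + 2)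
                 * (jacobi (mu + 1) (- mu - 1) n x
                    / jacobi (mu + 1) (- mu - 1) n 1)
        /\
        Il x = (1 + x) `^ (mu + 1) / Gamma (mu + 2)
                 * (jacobi (- mu - 1) (mu + 1) n x
                    / jacobi (mu + 1) (- mu - 1) n 1)).
Proof.
move=> Ir Il.
have [mu1 mu2] := hmu; have [t1 t2] := htheta.
have k1 : 1 <= k%:R :> R by rewrite ler1n.
have mu0 : 0 < mu by lra.
have mu10 : 0 < mu + 1 by lra.
(* Since [mu > k - 1], the bound [mu + 1 <= n] gives [k <= n]: the primitives up to order [k] are
   derivatives in Rodrigues' formula and vanish at both ends. *)
have kn : (k <= n)%N by rewrite -(ler_nat R); lra.
have IrE x : x <= 1 -> Ir x = powsum (legendre_coef1 n) n.+1 (mu + 1) x.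
  exact: frac_int_right_legendre.
have IlE x : -1 <= x ->
    Il x = powsum (fun j => (-1) ^+ n * legendre_coef1 n j) n.+1 (mu + 1) (- x).
  exact: frac_int_left_legendre.
split; last first.
  move=> x /andP[x1 x2]; have mu2E : mu + 2 = mu + 1 + 1 by ring.
  have negE : - mu - 1 = - (mu + 1) by ring.
  rewrite mu2E negE; split; first by rewrite IrE// powsum_jacobi.
  (* The left-sided form is the right-sided one at [- x] times [(-1) ^+ n], and reflection of the
     Jacobi polynomial exchanges its parameters with the same sign. *)
  rewrite IlE// -powsumZ powsum_jacobi//; last by rewrite lerNl.
  by rewrite (@jacobi_reflection _ (mu + 1)) ?subrr// opprK; ring.
have [k' kE] : exists k', k = k'.+1 by exists k.-1; rewrite prednK.
have N11 : -1 < 1 :> R by lra.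
have [_ ack] := hu k' (eq_leq (esym kE)).
have [g ig [_ gae]] := abs_cont_FTC N11 ack.
have {}gae : derive_on_n `[-1, 1] k u = g %[ae lebesgue_measure in `[-1, 1]%classic].
  by rewrite kE.
have gsub a b : -1 <= a -> b <= 1 ->
    derive_on_n `[-1, 1] k u = g %[ae lebesgue_measure in `]a, b[%classic].
  move=> a1 b1; apply: ae_subset gae => x /=; rewrite !in_itv/= => /andP[ax xb].
  by rewrite (le_trans a1 (ltW ax)) (le_trans (ltW xb)).
have igS (D : set R) : measurable D -> lebesgue_measure.-integrable D (EFin \o g).
  by move=> mD; apply: integrableS ig.
rewrite /legendre_coef; congr (_ * _).
rewrite (legendre_coef_parts kn hu).
set c := legendre_coef1 n.
rewrite (@Rintegral_ae_nonmeasurable _ _ _ (fun x => g x * powsum c n.+1 k%:R x)); last first.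
  by apply: ae_impl (gsub _ _ (lexx _) (lexx _)) => x gx xin; rewrite gx.
have [M HM] := powsum_bounded c n.+1 (ler0n R k).
have igp : lebesgue_measure.-integrable `](-1 : R), 1[ (EFin \o (fun x => g x * powsum c n.+1 k%:R x)).
  apply: (@integrable_boundedM _ _ _ _ _ M).
  - exact: igS.
  - by apply: measurable_funTS; exact: measurable_powsum.
  - by move=> x /andP[x1 x2]; apply: HM; rewrite !ltW.
(* The integral is cut at [theta] only now, after all integer steps, when the integrand involves
   just the representative [g] of the [k]-th derivative. *)
have := Rintegral_itvB igp (x := theta); rewrite !bnd_simp => /(_ (ltW t1) t2).
rewrite [X in _ - X]Rintegral_itv_oo => /(canRL (subrK _)) ->.
have r0 : 0 <= k%:R - mu by rewrite subr_ge0.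
(* The order of the primitive is split so that [k - mu] passes to [g] and [mu] stays on the Legendre
   polynomial. *)
have kE' : k%:R = mu + (k%:R - mu) by ring.
have -> : \int[lebesgue_measure]_(x in `]theta, 1[) (g x * powsum c n.+1 k%:R x) =
    Ir theta * lim (v x @[x --> theta^'+]) + RS_integral_oo theta 1 Ir v.
  rewrite {1}kE'; apply: caputo_left_parts => //.
  - exact: ltW.
  - exact: ltW.
  - exact: igS.
  - have := @frac_int_left_ae _ theta 1 (k%:R - mu) _ _ (gsub _ _ (ltW t1) (lexx _)).
    apply: ae_impl2; last first.
      by apply: (ae_subset _ huv); exact: subset_itv_oo_cc.
    by move=> x cv gv xin; rewrite -gv// -cv.
  - by move=> x /andP[_ x1]; exact: IrE.
have -> : \int[lebesgue_measure]_(x in `]-1, theta[) (g x * powsum c n.+1 k%:R x) =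
    Il theta * lim (w x @[x --> theta^'-]) - RS_integral_oo (-1) theta Il w.
  rewrite -(@caputo_right_parts _ (fun j => (-1) ^+ n * c j) n.+1 theta mu
    (k%:R - mu) ((-1) ^+ k) g w Il)//.
  - rewrite -kE' -RintegralZl//; last first.
      have [M' HM'] := powsum_bounded (fun j => (-1) ^+ n * c j) n.+1 (ler0n R k).
      apply: (@integrable_boundedM _ _ _ _ _ M').
      + exact: igS.
      + apply: measurable_funTS.
        exact: measurableT_comp (measurable_powsum _ _ _) _.
      + move=> x /andP[x1 x2]; apply: HM'.
        by rewrite lerNl opprK lerNl (ltW x1) (ltW (lt_trans x2 t2)).
    apply: eq_Rintegral => x; rewrite inE/= in_itv/= => /andP[x1 x2].
    rewrite powsum_legendre_opp//; last by rewrite (ltW x1) (ltW (lt_trans x2 t2)).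
    by rewrite mulrCA.
  - exact: ltW.
  - exact: ltW.
  - by rewrite -expr2 sqrr_sign.
  - exact: igS.
  - have := @frac_int_right_ae _ (-1) theta (k%:R - mu) _ _ (gsub _ _ (lexx _) (ltW t2)).
    apply: ae_impl2; last first.
      by apply: (ae_subset _ huw); exact: subset_itv_oo_cc.
    by move=> x cw gw xin; rewrite -gw// -cw.
  - by move=> x /andP[x1 _]; exact: IlE.
by rewrite addrA.
Qed.
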